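(* The following computational tasks are in the $\Omega$-cluster: - For $f\in W^{1,1}$, provide an enumeration of all points in $[0,1]$ where $f$ is discontinuous. - For $f\in W^{1,1}$, find $\sup_{x\in[0,1]}f(x)$.
   Context: $f:[0,1]\to\mathbb R$ is in $BV$ if there is $k_0\in\mathbb N$ with $\sum_i|f(x_i)-f(x_{i+1})|\le k_0$ for every partition of $[0,1]$. $W^{1,1}$ is the class of functions $f:[0,1]\to\mathbb R$ in $BV$ (and in $L_1$) which have a weak derivative in $L_1$, i.e. there is $v\in L_1$ with $\int_0^1 f(t)\varphi'(t)\,dt=-\int_0^1 v(t)\varphi(t)\,dt$ for all infinitely differentiable $\varphi:[0,1]\to\mathbb R$ with $\varphi(0)=\varphi(1)=0$. Elements are actual functions (not equivalence classes). The empty set is enumerated by a designated null sequence. $\Omega$-cluster: $\Omega(X)$ is defined for $X\subset[0,1]$ with $|X|\le 1$ and outputs a finite sequence that includes all elements of $X$. The $\Omega$-cluster is the class of partial functionals $\Phi$ computationally equivalent to $\Omega$ modulo $\exists^2$, i.e. $\Phi$ is computable in $\Omega$ and $\exists^2$, and $\Omega$ is computable in $\Phi$ and $\exists^2$. A computational task defines the class of functionals performing it; such a class is in the $\Omega$-cluster if $\Omega$ is computable, modulo $\exists^2$, in all elements of the class and at least one element of the class is in the $\Omega$-cluster. Here $\exists^2:\mathbb N^{\mathbb N}\to\{0,1\}$ satisfies $\exists^2(f)=0$ iff $f(n)=0$ for some $n$. Representations: reals are fast-converging Cauchy sequences of rationals ($|q_n-q_{n+i}|<2^{-n}$); functions on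 the reals are functionals respecting equality of reals; sets are given by characteristic functions. Computability: Kleene's S1–S9, where partial functionals of type rank $\le 3$ (taking only total arguments, possibly undefined) are allowed as oracles. That is, $\{e\}(\vec\phi)\simeq a$ is the least relation closed under Kleene's schemes: successor, constants, projection to a number argument, composition, primitive recursion, permutation of arguments, application of an argument, and S9: $\{e\}(m,\vec\phi,\vec\psi)\simeq\{m\}(\vec\phi)$. An application of $\phi_i$ to functionals $\lambda\vec\xi.\{d\}(\vec\xi,\vec\phi)$ has a value iff these functionals are total and $\phi_i$ is defined on them. A partial functional $\psi$ is computable in $\vec\phi$ if for some $e$, $\{e\}(\vec\xi,\vec\phi)\simeq\psi(\vec\xi)$ for all total $\vec\xi$ for which $\psi(\vec\xi)$ is defined. Functionals with outputs such as sequences or reals are viewed as $\mathbb N$-valued with an extra argument. *)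

(* Defs.v *)
From mathcomp Require Import all_boot all_order all_algebra.
From mathcomp Require Import all_classical all_reals all_analysis.
Import Order.TTheory GRing.Theory Num.Theory numFieldNormedType.Exports.

Set Implicit Arguments.
Unset Strict Implicit.
Unset Printing Implicit Defensive.

Inductive ty := tN | tA of ty & ty.

Declare Scope ty_scope.
Delimit Scope ty_scope with ty.
Bind Scope ty_scope with ty.
Notation "s ⇒ t" := (tA s t) (at level 55, right associativity) : ty_scope.

Fixpoint rank (s : ty) : nat :=
  if s is (a ⇒ b)%ty then maxn (rank a).+1 (rank b) else 0.

Fixpoint tot (s : ty) : Type :=
  if s is (a ⇒ b)%ty then tot a -> tot b else nat.

(* Every type is s_1 ⇒ ... ⇒ s_k ⇒ tN; [args] is the product of the [tot s_i]. *)
Fixpoint args (s : ty) : Type :=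
  if s is (a ⇒ b)%ty then (tot a * args b)%type else unit.

Fixpoint appl (s : ty) : tot s -> args s -> nat :=
  match s with
  | tN => fun n _ => n
  | (a ⇒ b)%ty => fun F xi => appl (F xi.1) xi.2
  end.

(* Partial functionals take total arguments only; [None] means undefined. *)
Definition pfun (s : ty) : Type := args s -> option nat.

Definition pfun_of_tot (s : ty) (F : tot s) : pfun s :=
  fun xi => Some (appl F xi).

Definition arg : Type := {s : ty & pfun s}.

Definition parg (s : ty) (F : pfun s) : arg := Tagged pfun F.
Definition targ (s : ty) (F : tot s) : arg := parg (pfun_of_tot F).
Definition num (n : nat) : arg := targ (n : tot tN).

Fixpoint items (s : ty) : args s -> seq {t : ty & tot t} :=
  match s with
  | tN => fun _ => [::]
  | (a ⇒ b)%ty => fun xi => Tagged tot xi.1 :: items xi.2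
  end.

Definition arglist (s : ty) (xi : args s) : seq arg :=
  [seq targ (tagged g) | g <- items xi].

(* [kleene e phi a] is {e}(phi) ≃ a.  Indices are natural numbers, coding
   finite sequences of numbers headed by the number of the scheme.  A number
   argument is an argument of type [tN], so S7 is the case of S8 in which
   phi_i takes number arguments only. *)
Inductive kleene : nat -> seq arg -> nat -> Prop :=
| S1_succ n phi :
    kleene (CodeSeq.code [:: 1]) (num n :: phi) n.+1
| S2_const q phi :
    kleene (CodeSeq.code [:: 2; q]) phi q
| S3_proj n phi :
    kleene (CodeSeq.code [:: 3]) (num n :: phi) n
| S4_comp e1 e2 phi n a :
    kleene e2 phi n ->
    kleene e1 (num n :: phi) a ->
    kleene (CodeSeq.code [:: 4; e1; e2]) phi a
| S5_rec0 e1 e2 phi a :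
    kleene e1 phi a ->
    kleene (CodeSeq.code [:: 5; e1; e2]) (num 0 :: phi) a
| S5_recS e1 e2 n phi b a :
    kleene (CodeSeq.code [:: 5; e1; e2]) (num n :: phi) b ->
    kleene e2 (num n :: num b :: phi) a ->
    kleene (CodeSeq.code [:: 5; e1; e2]) (num n.+1 :: phi) a
| S6_perm e1 (p : seq nat) phi a :
    perm_eq p (iota 0 (size phi)) ->
    kleene e1 [seq nth (num 0) phi i | i <- p] a ->
    kleene (CodeSeq.code [:: 6, e1 & p]) phi a
| S8_appl i (ds : seq nat) phi (F : arg) (psi : args (tag F)) a :
    onth phi i = Some F ->
    size ds = size (items psi) ->
    (* the j-th argument psi_j of F is λxi.{ds_j}(xi, phi), and is total *)
    (forall j (G : {t : ty & tot t}), onth (items psi) j = Some G ->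
       forall xi : args (tag G),
         kleene (nth 0 ds j) (arglist xi ++ phi) (appl (tagged G) xi)) ->
    tagged F psi = Some a ->
    kleene (CodeSeq.code [:: 8, i & ds]) phi a
| S9_univ m phi psi a :
    kleene m phi a ->
    kleene (CodeSeq.code [:: 9; size phi]) (num m :: phi ++ psi) a.

Definition computable (s : ty) (psi : pfun s) (phi : seq arg) : Prop :=
  exists e : nat, forall (xi : args s) (a : nat),
    psi xi = Some a -> kleene e (arglist xi ++ phi) a.

Definition E2 : tot ((tN ⇒ tN) ⇒ tN) :=
  fun f => if `[< exists n, f n = 0 >] then 0 else 1.

Definition computable_mod_E2 (s t : ty) (psi : pfun s) (phi : pfun t) : Prop :=
  computable psi [:: parg phi; targ E2].

(* "Nat-valued with extra arguments": a real is a map nat -> nat, a finite or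
   infinite sequence of reals is a map nat -> nat -> nat. *)
Notation tReal := (tN ⇒ tN)%ty.
Notation tSeq := (tN ⇒ tReal)%ty.
Notation tFun := (tReal ⇒ tReal)%ty.
Notation tSet := (tReal ⇒ tN)%ty.

Local Open Scope classical_set_scope.
Local Open Scope ring_scope.

Definition rat_of_code (n : nat) : rat :=
  if CodeSeq.decode n is [:: a; b; c] then (a%:Q - b%:Q) / c.+1%:Q else 0.

Definition names_real (R : realType) (alpha : tot tReal) (x : R) : Prop :=
  let q n := rat_of_code (alpha n) in
  (forall n i : nat, `|q n - q (n + i)%N| < 2 ^- n) /\
  (fun n => ratr (q n) : R) @ \oo --> x.

(* Only names of points of [0,1] matter.  That the functional respects equality
   of reals is part of the definition, as alpha is an arbitrary name of x. *)
Definition names_fun (R : realType) (F : tot tFun) (f : R -> R) : Prop :=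
  forall (alpha : tot tReal) (x : R), x \in `[0, 1] ->
    names_real alpha x -> names_real (F alpha) (f x).

Definition names_set (R : realType) (F : tot tSet) (X : set R) : Prop :=
  forall (alpha : tot tReal) (x : R), x \in `[0, 1] ->
    names_real alpha x -> F alpha = (`[< X x >] : nat).

(* The length is stored in [s 0 0], the i-th element (from 0) in [s i.+1]. *)
Definition names_finseq (R : realType) (s : tot tSeq) (w : seq R) : Prop :=
  s 0%N 0%N = size w /\
  forall i : nat, (i < size w)%N -> names_real (s i.+1) w`_i.

(* The designated null sequence is the constant sequence -1, which cannot
   enumerate a nonempty subset of [0,1]. *)
Definition enumerates (R : realType) (s : tot tSeq) (A : set R) : Prop :=
  (exists x : nat -> R, (forall n, names_real (s n) (x n)) /\ range x = A) \/
  (A = set0 /\ forall n, names_real (s n) (-1 : R)).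

Record task := Task {
  task_in : ty;
  task_out : ty;
  task_obj : Type;
  task_name : tot task_in -> task_obj -> Prop;
  task_sol : task_obj -> tot task_out -> Prop }.

Definition performs (T : task) (Phi : pfun (task_in T ⇒ task_out T)) : Prop :=
  forall (F : tot (task_in T)) (x : task_obj T), task_name F x ->
    exists2 s : tot (task_out T), task_sol x s &
      forall xi : args (task_out T), Phi (F, xi) = Some (appl s xi).

Definition Omega_task (R : realType) : task :=
  @Task tSet tSeq (set R)
    (fun F X => [/\ X `<=` `[0, 1], is_subset1 X & names_set F X])
    (fun X s => exists2 w : seq R, names_finseq s w &
       forall x, X x -> x \in w).

(* The specification leaves the output of Ω open (which finite sequence, and
   which names of its elements), so it is a predicate. *)
Definition is_Omega (R : realType) (Omega : pfun (tSet ⇒ tSeq)) : Prop :=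
  @performs (Omega_task R) Omega /\
  forall (F : tot tSet) (xi : args tSeq),
    ~ (exists X : set R, @task_name (Omega_task R) F X) -> Omega (F, xi) = None.

(* Computing Ω means computing some functional as specified; computing from Ω
   means computing from whichever such functional is given. *)
Definition Omega_computable_in (R : realType) (s : ty) (Phi : pfun s) : Prop :=
  exists2 Omega, is_Omega R Omega & computable_mod_E2 Omega Phi.

Definition computable_in_Omega (R : realType) (s : ty) (Phi : pfun s) : Prop :=
  forall Omega, is_Omega R Omega -> computable_mod_E2 Phi Omega.

Definition Omega_cluster (R : realType) (s : ty) (Phi : pfun s) : Prop :=
  [/\ (rank s <= 3)%N, computable_in_Omega R Phi & Omega_computable_in R Phi].

Definition task_in_Omega_cluster (R : realType) (T : task) : Prop :=
  (forall Phi, @performs T Phi -> Omega_computable_in R Phi) /\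
  (exists2 Phi, @performs T Phi & Omega_cluster R Phi).

(* [h] is the derivative of [g] on [0,1], one-sided at the end-points. *)
Definition is_derive01 (R : realType) (g h : R -> R) : Prop :=
  forall x : R, x \in `[0, 1] ->
    (fun y => (g y - g x) / (y - x)) @ within `[0, 1] x^' --> h x.

Definition L1_01 (R : realType) (g : R -> R) : Prop :=
  (@lebesgue_measure R).-integrable `[0, 1] (EFin \o g).

(* An infinitely differentiable function on [0,1] is given together with its
   derivatives: [D n] is the n-th derivative of [D 0]. *)
Definition weak_derivative (R : realType) (f v : R -> R) : Prop :=
  forall D : nat -> R -> R,
    (forall n, is_derive01 (D n) (D n.+1)) -> D 0%N 0 = 0 -> D 0%N 1 = 0 ->
    \int[@lebesgue_measure R]_(t in `[0, 1]) (f t * D 1%N t) =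
    - \int[@lebesgue_measure R]_(t in `[0, 1]) (v t * D 0%N t).

Definition W11 (R : realType) (f : R -> R) : Prop :=
  [/\ bounded_variation 0 1 f, L1_01 f &
      exists2 v : R -> R, L1_01 v & weak_derivative f v].

Definition discontinuities (R : realType) (f : R -> R) : set R :=
  [set x : R | x \in `[0, 1] /\ ~ (f @ within `[0, 1] (nbhs x) --> f x)].

Definition W11_discontinuities_task (R : realType) : task :=
  @Task tFun tSeq (R -> R)
    (fun F f => W11 f /\ names_fun F f)
    (fun f s => enumerates s (discontinuities f)).

Definition W11_sup_task (R : realType) : task :=
  @Task tFun tReal (R -> R)
    (fun F f => W11 f /\ names_fun F f)
    (fun f s => names_real s (sup (f @` `[0, 1]))).

(* Main.v *)
(** Only bounded variation matters for computing the two tasks from Omega.  A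
    function [f] of bounded variation has one-sided limits, so the set of points
    where [f] jumps by more than [2 ^- k] relative to its values at nearby
    rationals has no accumulation point and is decidable by E2 from names; its
    union over [k] is the set of discontinuities.  The least such point [x] above
    a rational [p] is found by recursion: a point [z] of the set is the least one
    iff no smaller point is, and since at most one point can be the least, Omega
    applies to [{z' < z | z' is the least one}] and exhibits a smaller point if
    there is one.  This recursion is well founded because every nonempty set of
    jumps has a minimum, and it is coded by self-application through S9.  As every
    jump is isolated from the left, it is the least one above some rational, and
    letting [p] and [k] vary enumerates all discontinuities.  The supremum of [f]
    is the supremum of its values at the rationals and at the discontinuities.
    Outputs must not depend on the choice of Omega, hence reals are always
    returned through the name built from their lower Dedekind cut.

    Conversely, for a set [X] with at most one element, the indicator of [X] and
    [y * 1_X(y)] vanish almost everywhere, hence belong to W11; the discontinuities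
    of the former are the points of [X], and the supremum of the latter is the
    element of [X] if there is one. *)

From Pilot Require Import Defs.
From mathcomp Require Import all_boot all_order all_algebra.
From mathcomp Require Import all_classical all_reals all_analysis.
From mathcomp Require Import measurable_realfun ring lra zify.
Import Order.TTheory GRing.Theory Num.Theory numFieldNormedType.Exports.
Import Pilot.Defs.

Set Implicit Arguments.
Unset Strict Implicit.
Unset Printing Implicit Defensive.

(** * Uniform Kleene computability *)

(* One index works for all [x : E]; side conditions on the arguments, including
   induction hypotheses about other indices, are put into the type [E]. *)
Definition ucomp (E : Type) (phi : E -> seq arg) (f : E -> nat) : Prop :=
  exists e, forall x, kleene e (phi x) (f x).

Definition udec (E : Type) (phi : E -> seq arg) (b : E -> bool) : Prop :=
  ucomp phi (fun x => b x : nat).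

Definition push (E : Type) (phi : E -> seq arg) : E * nat -> seq arg :=
  fun y => num y.2 :: phi y.1.
Definition pushf (E : Type) (phi : E -> seq arg) : E * tot tReal -> seq arg :=
  fun y => targ y.2 :: phi y.1.
Definition plet (E : Type) (a : E -> nat) (phi : E -> seq arg) : E -> seq arg :=
  fun x => num (a x) :: phi x.

Definition sized (E : Type) (phi : E -> seq arg) : Prop :=
  exists N, forall x, size (phi x) = N.

Section Basic.
Variables (E : Type) (phi : E -> seq arg).

Lemma ucomp_ext (f g : E -> nat) : f =1 g -> ucomp phi f -> ucomp phi g.
Proof. by move=> fg [e H]; exists e => x; rewrite -fg. Qed.

Lemma ucomp_reindex (E' : Type) (g : E' -> E) (f : E -> nat) :
  ucomp phi f -> ucomp (phi \o g) (f \o g).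
Proof. by move=> [e H]; exists e => x; apply: H. Qed.

Lemma ucomp_const q : ucomp phi (fun=> q).
Proof. by exists (CodeSeq.code [:: 2; q]) => x; apply: S2_const. Qed.

Lemma ucomp_var i (f : E -> nat) :
  (forall x, onth (phi x) i = Some (num (f x))) -> ucomp phi f.
Proof.
move=> H; exists (CodeSeq.code [:: 8, i & [::]]) => x.
by apply: (@S8_appl i [::] (phi x) (num (f x)) tt) => // -[].
Qed.

Lemma ucomp_let (a f : E -> nat) :
  ucomp phi a -> ucomp (plet a phi) f -> ucomp phi f.
Proof.
move=> [e2 H2] [e1 H1]; exists (CodeSeq.code [:: 4; e1; e2]) => x.
exact: S4_comp (H2 x) (H1 x).
Qed.

Lemma ucomp_succ (f : E -> nat) : ucomp phi f -> ucomp phi (fun x => (f x).+1).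
Proof.
move=> H; apply: (ucomp_let H).
by exists (CodeSeq.code [:: 1]) => x; apply: S1_succ.
Qed.

Lemma ucomp_rec (n b : E -> nat) (h : E -> nat -> nat -> nat) :
  ucomp phi n -> ucomp phi b ->
  ucomp (push (push phi)) (fun y => h y.1.1 y.2 y.1.2) ->
  ucomp phi (fun x => nat_rec (fun=> nat) (b x) (h x) (n x)).
Proof.
move=> Hn [e1 H1] [e2 H2]; apply: (ucomp_let Hn).
exists (CodeSeq.code [:: 5; e1; e2]) => x; rewrite /plet.
elim: (n x) => [|k IH]; first exact: S5_rec0.
exact: S5_recS IH (H2 (x, _, k)).
Qed.

Lemma ucomp_appvar i (a : E -> nat -> nat) (t : E -> nat) :
  (forall x, onth (phi x) i = Some (targ (a x : tot tReal))) ->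
  ucomp phi t -> ucomp phi (fun x => a x (t x)).
Proof.
move=> Ha [e He]; exists (CodeSeq.code [:: 8, i & [:: e]]) => x.
apply: (@S8_appl i [:: e] (phi x) (targ (a x : tot tReal)) (t x, tt)) => //.
by move=> [|[|j]] G //= [<-] /= xi; apply: He.
Qed.

Lemma ucomp_E2 i (h : E -> nat -> nat) :
  (forall x, onth (phi x) i = Some (targ E2)) ->
  ucomp (push phi) (fun y => h y.1 y.2) -> ucomp phi (fun x => E2 (h x)).
Proof.
move=> HE [e He]; exists (CodeSeq.code [:: 8, i & [:: e]]) => x.
apply: (@S8_appl i [:: e] (phi x) (targ E2) (h x, tt)) => //.
by move=> [|[|j]] G //= [<-] /= [n []] /=; apply: (He (x, n)).
Qed.

Lemma ucomp_fun i (G : E -> tot tFun) (b : E -> nat -> nat) (t : E -> nat) :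
  (forall x, onth (phi x) i = Some (targ (G x))) ->
  ucomp (push phi) (fun y => b y.1 y.2) -> ucomp phi t ->
  ucomp phi (fun x => G x (b x) (t x)).
Proof.
move=> HG [e He] [e' He']; exists (CodeSeq.code [:: 8, i & [:: e; e']]) => x.
apply: (@S8_appl i [:: e; e'] (phi x) (targ (G x)) (b x, (t x, tt))) => //.
move=> [|[|[|j]]] F //= [<-] /=; first by move=> [n []] /=; apply: (He (x, n)).
by move=> xi; apply: He'.
Qed.

Lemma ucomp_Omega i (Om : E -> pfun (tSet ⇒ tSeq)) (F : E -> tot tSet)
    (a b f : E -> nat) :
  (forall x, onth (phi x) i = Some (parg (Om x))) ->
  ucomp (pushf phi) (fun y => F y.1 y.2) -> ucomp phi a -> ucomp phi b ->
  (forall x, Om x (F x, (a x, (b x, tt))) = Some (f x)) ->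
  ucomp phi f.
Proof.
move=> HO [e He] [ea Ha] [eb Hb] Hf.
exists (CodeSeq.code [:: 8, i & [:: e; ea; eb]]) => x.
apply: (@S8_appl i [:: e; ea; eb] (phi x) (parg (Om x))
         (F x, (a x, (b x, tt)))) => //; last exact: Hf.
move=> [|[|[|[|j]]]] G //= [<-] /=; first by move=> [z []]; apply: (He (x, z)).
- by move=> xi; apply: Ha.
- by move=> xi; apply: Hb.
Qed.

(** S6 brings the index and the arguments listed in [ps] to the front; S9 then runs the index on
    these and forgets the rest. With a constant index this yields weakening, with an index held in a
    variable it yields self-application. *)
Lemma ucomp_univ (ps : seq nat) (m f : E -> nat) :
  sized phi -> uniq ps -> (forall x, all (fun i => i < size (phi x)) ps) ->
  ucomp phi m ->
  (forall x, kleene (m x) [seq nth (num 0) (phi x) i | i <- ps] (f x)) ->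
  ucomp phi f.
Proof.
move=> [N HN] Ups Hps Hm Hf; apply: (ucomp_let Hm).
pose rest := [seq i <- iota 0 N | i \notin ps].
exists (CodeSeq.code [:: 6, CodeSeq.code [:: 9; size ps] &
  0 :: [seq i.+1 | i <- ps ++ rest]]) => x.
have sub i : i \in ps -> i < N by move/(allP (Hps x)); rewrite HN.
apply: S6_perm.
  rewrite /= HN perm_cons -[1]addn0 iotaDl perm_map //.
  apply: uniq_perm; rewrite ?iota_uniq // ?cat_uniq ?Ups ?filter_uniq ?iota_uniq //.
    rewrite andbT; apply/hasPn => i; rewrite mem_filter => /andP[].
    by [].
  move=> i; rewrite mem_cat mem_filter mem_iota add0n /=.
  by case: (boolP (i \in ps)) => [/sub->|].
rewrite /= -map_comp map_cat.
have -> : size ps = size [seq nth (num 0) (phi x) i | i <- ps] by rewrite size_map.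
exact: S9_univ.
Qed.

End Basic.

(** The condition uses iterated [behead] so that it holds by computation when [phi'] is built from
    [phi] by [push], [pushf] and [plet]. *)
Lemma ucomp_weak (E E' : Type) k (g : E' -> E) (phi : E -> seq arg)
    (phi' : E' -> seq arg) (f : E -> nat) :
  sized phi -> (forall y, iter k behead (phi' y) = phi (g y)) ->
  (forall y, k <= size (phi' y)) ->
  ucomp phi f -> ucomp phi' (fun y => f (g y)).
Proof.
move=> [N HN] Hd Hk [e He].
have Hs y : size (phi' y) = k + N.
  by rewrite -(HN (g y)) -Hd -drop_behead size_drop subnKC.
apply: (@ucomp_univ _ phi' (iota k N) (fun=> e)); first by exists (k + N).
- exact: iota_uniq.
- by move=> y; apply/allP => i; rewrite mem_iota Hs => /andP[].
- exact: ucomp_const.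
- by move=> y; rewrite map_nth_iota ?Hs ?addKn // drop_behead Hd
    -(HN (g y)) take_size.
Qed.

(** A program for [b] expects its argument directly in front of [phi]: the value of [t] is put there
    and the [k] arguments in between are dropped. *)
Lemma ucomp_fapp (E E' : Type) k (g : E' -> E) (phi : E -> seq arg)
    (phi' : E' -> seq arg) (b : E -> nat -> nat) (t : E' -> nat) :
  sized phi -> (forall y, iter k behead (phi' y) = phi (g y)) ->
  (forall y, k <= size (phi' y)) ->
  ucomp (push phi) (fun y => b y.1 y.2) -> ucomp phi' t ->
  ucomp phi' (fun y => b (g y) (t y)).
Proof.
move=> [N HN] Hd Hk [e He] Ht.
have Hs y : size (phi' y) = k + N.
  by rewrite -(HN (g y)) -Hd -drop_behead size_drop subnKC.
apply: (ucomp_let Ht).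
apply: (@ucomp_univ _ (plet t phi') (0 :: iota k.+1 N) (fun=> e)).
- by exists (k + N).+1 => y /=; rewrite Hs.
- by rewrite /= iota_uniq mem_iota.
- move=> y /=; apply/allP => i; rewrite mem_iota /= Hs ltnS.
  by case/andP.
- exact: ucomp_const.
- move=> y /=; rewrite map_nth_iota /= ?Hs ?subSS ?addKn // drop_behead Hd
    -(HN (g y)) take_size.
  exact: (He (g y, t y)).
Qed.

(** Recursion S5 at 0 or 1 evaluates [f] in both cases but [g] only when [b] holds. So [g] may be a
    program that is correct only under [b], as a recursive call is. *)
Lemma ucomp_if (E : Type) (phi : E -> seq arg) (b : E -> bool) (f g : E -> nat) :
  sized phi -> udec phi b -> ucomp phi f ->
  ucomp (fun y : {x | b x} => phi (sval y)) (fun y => g (sval y)) ->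
  ucomp phi (fun x => if b x then g x else f x).
Proof.
move=> [N HN] Hb Hf Hg; apply: (ucomp_let Hb); have [e1 H1] := Hf.
(* At 1 the recursor passes the counter 0 and the value of [f] to the second program, which has to
   skip both. *)
have : ucomp (fun y : {x | b x} => [:: num 0, num (f (sval y)) & phi (sval y)])
    (fun y => g (sval y)).
  have sz : sized (fun y : {x | b x} => phi (sval y)) by exists N => y; rewrite HN.
  by apply: (ucomp_weak (k := 2) (g := id) sz _ _ Hg).
move=> [e2 H2]; exists (CodeSeq.code [:: 5; e1; e2]) => x; rewrite /plet.
case: ifP => bx /=; last exact: S5_rec0.
apply: (S5_recS (b := f x)); first exact: S5_rec0.
exact: (H2 (exist _ x bx)).
Qed.

Lemma sized_push (E : Type) (phi : E -> seq arg) : sized phi -> sized (push phi).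
Proof. by move=> [N HN]; exists N.+1 => y; rewrite /= HN. Qed.

Lemma sized_pushf (E : Type) (phi : E -> seq arg) : sized phi -> sized (pushf phi).
Proof. by move=> [N HN]; exists N.+1 => y; rewrite /= HN. Qed.

Lemma sized_plet (E : Type) (a : E -> nat) (phi : E -> seq arg) :
  sized phi -> sized (plet a phi).
Proof. by move=> [N HN]; exists N.+1 => y; rewrite /= HN. Qed.

#[local] Hint Resolve sized_push sized_pushf sized_plet : ctx.

Ltac uvar := first
  [ exact: (ucomp_var (i := 0)) | exact: (ucomp_var (i := 1))
  | exact: (ucomp_var (i := 2)) | exact: (ucomp_var (i := 3))
  | exact: (ucomp_var (i := 4)) | exact: (ucomp_var (i := 5))
  | exact: (ucomp_var (i := 6)) | exact: (ucomp_var (i := 7))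
  | exact: (ucomp_var (i := 8)) | exact: (ucomp_var (i := 9)) ].

(** * Primitive recursive arithmetic and Boolean connectives *)

Section Arithmetic.
Variables (E : Type) (phi : E -> seq arg).

Lemma ucomp_pred (a : E -> nat) : ucomp phi a -> ucomp phi (fun x => (a x).-1).
Proof.
move=> Ha; apply: (@ucomp_ext _ _
  (fun x => nat_rec (fun=> nat) 0 (fun k _ => k) (a x))).
  by move=> x; case: (a x).
by apply: ucomp_rec => //; [exact: ucomp_const | uvar].
Qed.

Lemma ucomp_add (a b : E -> nat) :
  ucomp phi a -> ucomp phi b -> ucomp phi (fun x => a x + b x).
Proof.
move=> Ha Hb; apply: (@ucomp_ext _ _
  (fun x => nat_rec (fun=> nat) (b x) (fun _ r => r.+1) (a x))).
  by move=> x; elim: (a x) => //= n ->.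
by apply: ucomp_rec => //; apply: ucomp_succ; uvar.
Qed.

Lemma udec_neg (b : E -> bool) : udec phi b -> udec phi (fun x => ~~ b x).
Proof.
move=> Hb; apply: (@ucomp_ext _ _
  (fun x => nat_rec (fun=> nat) 1 (fun _ _ => 0) (b x))).
  by move=> x; case: (b x).
by apply: ucomp_rec => //; exact: ucomp_const.
Qed.

Lemma udec_and (b c : E -> bool) :
  udec phi b -> udec phi c -> udec phi (fun x => b x && c x).
Proof.
move=> Hb Hc; apply: (@ucomp_ext _ _ (fun x => (b x + c x).-1)).
  by move=> x; case: (b x); case: (c x).
by apply: ucomp_pred; apply: ucomp_add.
Qed.

Lemma udec_or (b c : E -> bool) :
  udec phi b -> udec phi c -> udec phi (fun x => b x || c x).
Proof.
move=> Hb Hc; apply: (@ucomp_ext _ _ (fun x => ~~ (~~ b x && ~~ c x))).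
  by move=> x; case: (b x); case: (c x).
by apply: udec_neg; apply: udec_and; apply: udec_neg.
Qed.

Lemma udec_imp (b c : E -> bool) :
  udec phi b -> udec phi c -> udec phi (fun x => b x ==> c x).
Proof.
move=> Hb Hc; apply: (@ucomp_ext _ _ (fun x => ~~ b x || c x)).
  by move=> x; case: (b x); case: (c x).
by apply: udec_or => //; apply: udec_neg.
Qed.

Lemma udec_eq0 (a : E -> nat) : ucomp phi a -> udec phi (fun x => a x == 0).
Proof.
move=> Ha; apply: (@ucomp_ext _ _
  (fun x => nat_rec (fun=> nat) 1 (fun _ _ => 0) (a x))).
  by move=> x; case: (a x).
by apply: ucomp_rec => //; exact: ucomp_const.
Qed.

End Arithmetic.

Section Comparison.
Variables (E : Type) (phi : E -> seq arg).

Lemma ucomp_sub (a b : E -> nat) :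
  ucomp phi a -> ucomp phi b -> ucomp phi (fun x => a x - b x).
Proof.
move=> Ha Hb; apply: (@ucomp_ext _ _
  (fun x => nat_rec (fun=> nat) (a x) (fun _ r => r.-1) (b x))).
  by move=> x; elim: (b x) => [|n /= ->]; rewrite ?subn0 // subnS.
by apply: ucomp_rec => //; apply: ucomp_pred; uvar.
Qed.

Lemma udec_leq (a b : E -> nat) :
  ucomp phi a -> ucomp phi b -> udec phi (fun x => a x <= b x).
Proof. by move=> Ha Hb; apply: udec_eq0; apply: ucomp_sub. Qed.

Lemma udec_eq (a b : E -> nat) :
  ucomp phi a -> ucomp phi b -> udec phi (fun x => a x == b x).
Proof.
move=> Ha Hb; apply: (@ucomp_ext _ _ (fun x => (a x <= b x) && (b x <= a x))).
  by move=> x; rewrite -eqn_leq.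
by apply: udec_and; apply: udec_leq.
Qed.

Hypothesis sz : sized phi.

Lemma ucomp_mul (a b : E -> nat) :
  ucomp phi a -> ucomp phi b -> ucomp phi (fun x => a x * b x).
Proof.
move=> Ha Hb; apply: (ucomp_let Hb); apply: (@ucomp_ext _ _
  (fun x => nat_rec (fun=> nat) 0 (fun _ r => b x + r) (a x))).
  by move=> x; elim: (a x) => //= n ->; rewrite mulSn.
apply: ucomp_rec; first exact: (ucomp_weak (k := 1) (g := id) sz _ _ Ha).
- exact: ucomp_const.
- by apply: ucomp_add; uvar.
Qed.
End Comparison.

(* Unbounded search by self-application: on input [m, k] the program returns
   [k] if the test succeeds and otherwise runs [m] on [m, k.+1]. *)
Lemma ucomp_mu (E : Type) (phi : E -> seq arg) (b : E -> nat -> bool)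
    (exb : forall x, exists k, b x k) :
  sized phi -> udec (push phi) (fun y => b y.1 y.2) ->
  ucomp phi (fun x => ex_minn (exb x)).
Proof.
move=> [N HN] Hb; pose mu x := ex_minn (exb x).
have bmu x : b x (mu x) by rewrite /mu; case: ex_minnP.
(* The induction hypothesis is part of the environment: the index [m] is assumed correct at the next
   candidate. Thus one index [d] is obtained before it is passed to itself. *)
pose good (y : E * nat * nat) := y.1.2 <= mu y.1.1 /\
  (y.1.2 < mu y.1.1 ->
     kleene y.2 [:: num y.2, num y.1.2.+1 & phi y.1.1] (mu y.1.1)).
pose psi (y : {y | good y}) := push (push phi) (sval y).
have Hsz : sized psi by exists N.+2 => y /=; rewrite HN.
have [d Hd] : ucomp psi (fun y => mu (sval y).1.1).
  apply: (@ucomp_ext _ _ (fun y => if ~~ b (sval y).1.1 (sval y).1.2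
      then mu (sval y).1.1 else (sval y).1.2)).
    move=> [[[x k] m] [/= kmu _]]; case: ifP => // /negbFE bk.
    apply/eqP; rewrite eqn_leq kmu /= /mu.
    by case: ex_minnP => n _ /(_ _ bk).
  apply: ucomp_if => //.
  - apply: udec_neg.
    apply: (ucomp_weak (k := 1) (g := fun y => (sval y).1) _ _ _ Hb) => //.
    by exists N.+1 => y /=; rewrite HN.
  - exact: (ucomp_var (i := 1)).
  - apply: (ucomp_let (a := fun y => (sval (sval y)).1.2.+1)).
      apply: ucomp_succ; exact: (ucomp_var (i := 1)).
    (* The context is [k.+1], [m], [k], [phi]; the call keeps [m], [k.+1], [phi]. *)
    apply: (ucomp_univ (ps := [:: 1, 0 & iota 3 N])
             (m := fun y => (sval (sval y)).2)).
    + by exists N.+3 => y /=; rewrite HN.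
    + by rewrite /= !inE !mem_iota iota_uniq.
    + move=> y /=; rewrite HN /=; apply/allP => i; rewrite mem_iota.
      by case/andP.
    + exact: (ucomp_var (i := 1)).
    + move=> [[[[x k] m] [/= kmu Hk]] /= nbk].
      rewrite map_nth_iota /= ?HN ?subSS ?subn0 // drop0 -(HN x) take_size.
      apply: Hk; rewrite ltn_neqAle kmu andbT.
      by apply: contraNneq nbk => ->.
(* The search starts at 0, with [d] supplied as its own index. *)
exists (CodeSeq.code [:: 4; CodeSeq.code [:: 4; d; CodeSeq.code [:: 2; d]];
  CodeSeq.code [:: 2; 0]]) => x.
have run k : k <= mu x -> kleene d [:: num d, num k & phi x] (mu x).
  move=> kmu; have [n] : exists n, n = mu x - k by exists (mu x - k).
  elim: n k kmu => [|n IH] k kmu Hn.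
    have ek : k = mu x by apply/eqP; rewrite eqn_leq kmu -subn_eq0 Hn eqxx.
    by apply: (Hd (exist good (x, k, d) _)); rewrite /good /= ek ltnn.
  apply: (Hd (exist good (x, k, d) _)); split => //= kmu'.
  by apply: IH => //; rewrite subnS -Hn.
apply: S4_comp (S2_const _ _) _; apply: S4_comp (S2_const _ _) _; exact: run.
Qed.

(** * Number quantifiers by [E2], and coding of sequences *)

Definition has_E2 (E : Type) (phi : E -> seq arg) : Prop :=
  sized phi /\ exists i, forall x, onth (phi x) i = Some (targ E2).

Lemma has_E2_sized (E : Type) (phi : E -> seq arg) : has_E2 phi -> sized phi.
Proof. by case. Qed.

Lemma has_E2_push (E : Type) (phi : E -> seq arg) : has_E2 phi -> has_E2 (push phi).
Proof.
by move=> [sz [i Hi]]; split; [auto with ctx | exists i.+1 => y; apply: Hi].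
Qed.

Lemma has_E2_pushf (E : Type) (phi : E -> seq arg) :
  has_E2 phi -> has_E2 (pushf phi).
Proof.
by move=> [sz [i Hi]]; split; [auto with ctx | exists i.+1 => y; apply: Hi].
Qed.

Lemma has_E2_plet (E : Type) (a : E -> nat) (phi : E -> seq arg) :
  has_E2 phi -> has_E2 (plet a phi).
Proof.
by move=> [sz [i Hi]]; split; [auto with ctx | exists i.+1 => y; apply: Hi].
Qed.

#[local] Hint Resolve has_E2_sized has_E2_push has_E2_pushf has_E2_plet : ctx.

Ltac uwk H := first
  [ exact: H
  | apply: (ucomp_weak (k := 1) _ _ _ H); by [auto with ctx | ]
  | apply: (ucomp_weak (k := 2) _ _ _ H); by [auto with ctx | ]
  | apply: (ucomp_weak (k := 3) _ _ _ H); by [auto with ctx | ]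
  | apply: (ucomp_weak (k := 4) _ _ _ H); by [auto with ctx | ]
  | apply: (ucomp_weak (k := 5) _ _ _ H); by [auto with ctx | ]
  | apply: (ucomp_weak (k := 6) _ _ _ H); by [auto with ctx | ] ].

Section Quantifiers.
Variables (E : Type) (phi : E -> seq arg).
Hypothesis HE : has_E2 phi.

Lemma udec_ex (b : E -> nat -> bool) :
  udec (push phi) (fun y => b y.1 y.2) ->
  udec phi (fun x => `[< exists n, b x n >]).
Proof.
move=> Hb; have [sz [i Hi]] := HE.
apply: (@ucomp_ext _ _ (fun x => E2 (fun n => ~~ b x n : nat) == 0)).
  move=> x; congr nat_of_bool; rewrite /E2.
  case: asboolP => [[n bn]|nb]; case: asboolP => //.
    by case; exists n; case: (b x n) bn.
  by case=> n bn; case: nb; exists n; rewrite bn.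
apply: udec_eq0; apply: (ucomp_E2 (h := fun x n => ~~ b x n : nat) Hi).
exact: udec_neg.
Qed.

Lemma udec_all (b : E -> nat -> bool) :
  udec (push phi) (fun y => b y.1 y.2) ->
  udec phi (fun x => `[< forall n, b x n >]).
Proof.
move=> Hb; apply: (@ucomp_ext _ _ (fun x => ~~ `[< exists n, ~~ b x n >])).
  move=> x; congr nat_of_bool; apply/negP/asboolP => [nb n|bx].
    by apply: contra_notT nb => bn; apply/asboolP; exists n.
  by move=> /asboolP[n]; rewrite bx.
by apply: udec_neg; apply: udec_ex; apply: udec_neg.
Qed.
End Quantifiers.

(** The expression is the recursion clause of [CodeSeq.code] for a list with head [n x] and tail
    coded by [m x]. *)
Lemma ucomp_code_cons (E : Type) (phi : E -> seq arg) (n m : E -> nat) :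
  sized phi -> ucomp phi n -> ucomp phi m ->
  ucomp phi (fun x => 2 ^ n x * (m x).*2.+1).
Proof.
move=> sz Hn Hm; apply: ucomp_mul => //.
  apply: (@ucomp_ext _ _
    (fun x => nat_rec (fun=> nat) 1 (fun _ r => r + r) (n x))).
    by move=> x; elim: (n x) => //= k ->; rewrite expnS mul2n addnn.
  by apply: ucomp_rec => //; [exact: ucomp_const | apply: ucomp_add; uvar].
apply: (@ucomp_ext _ _ (fun x => (m x + m x).+1)).
  by move=> x; rewrite addnn.
by apply: ucomp_succ; apply: ucomp_add.
Qed.

Lemma ucomp_code2 (E : Type) (phi : E -> seq arg) (a b : E -> nat) :
  sized phi -> ucomp phi a -> ucomp phi b ->
  ucomp phi (fun x => CodeSeq.code [:: a x; b x]).
Proof.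
move=> sz Ha Hb; do 2! apply: ucomp_code_cons => //; exact: ucomp_const.
Qed.

Lemma ucomp_code3 (E : Type) (phi : E -> seq arg) (a b c : E -> nat) :
  sized phi -> ucomp phi a -> ucomp phi b -> ucomp phi c ->
  ucomp phi (fun x => CodeSeq.code [:: a x; b x; c x]).
Proof.
move=> sz Ha Hb Hc; do 3! apply: ucomp_code_cons => //; exact: ucomp_const.
Qed.

(** * Decidable predicates on codes of rationals and names of reals *)

(** Comparison up to an error is taken as primitive: the order of rationals, cuts and the Cauchy
    condition are all number quantifications over it. *)
Definition plt (a b n : nat) : bool :=
  (rat_of_code a < rat_of_code b + 2 ^- n)%R.

(* [c] codes [(a - b) / d.+1]; a [c] that is not the code of a triple codes 0. *)
Definition rat_digits (c a b d : nat) : bool :=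
  (c == CodeSeq.code [:: a; b; d]) || [&& a == 0, b == 0, d == 0 &
    ~~ `[< exists a, `[< exists b, `[< exists d, c == CodeSeq.code [:: a; b; d] >] >] >]].

Lemma rat_digits_ex c : exists a b d, rat_digits c a b d.
Proof.
rewrite /rat_digits; case: (asboolP (exists a, _)) => [[a /asboolP[b /asboolP[d cE]]]|_].
  by exists a, b, d; rewrite cE.
by exists 0, 0, 0; rewrite /= orbT.
Qed.

Lemma rat_digitsP c a b d : rat_digits c a b d ->
  rat_of_code c = ((a%:Q - b%:Q) / d.+1%:Q)%R.
Proof.
rewrite /rat_of_code => /orP[/eqP->|]; first by rewrite CodeSeq.codeK.
move=> /and4P[/eqP-> /eqP-> /eqP-> /asboolP nc].
rewrite subrr mul0r.
case E : (CodeSeq.decode c) => [|a' [|b' [|c' []]]] //; case: nc.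
exists a'; apply/asboolP; exists b'; apply/asboolP; exists c'.
by rewrite -E CodeSeq.decodeK.
Qed.

(** The inequality of [plt] multiplied by both denominators and [2 ^ n], with negative terms moved
    across, so that only sums and products of natural numbers occur. *)
Definition plt_digits (a1 a2 a3 b1 b2 b3 n : nat) : bool :=
  (a1 * b3.+1 * 2 ^ n + b2 * a3.+1 * 2 ^ n <
   b1 * a3.+1 * 2 ^ n + a2 * b3.+1 * 2 ^ n + a3.+1 * b3.+1).

Lemma plt_digitsP a a1 a2 a3 b b1 b2 b3 n :
  rat_digits a a1 a2 a3 -> rat_digits b b1 b2 b3 ->
  plt a b n = plt_digits a1 a2 a3 b1 b2 b3 n.
Proof.
move=> /rat_digitsP Ha /rat_digitsP Hb; rewrite /plt Ha Hb.
rewrite /plt_digits -(@ltr_nat rat) !natrD !natrM natrX.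
have n3 : (0 < a3.+1%:R :> rat)%R by rewrite ltr0Sn.
have m3 : (0 < b3.+1%:R :> rat)%R by rewrite ltr0Sn.
have p2 : (0 < 2 ^+ n :> rat)%R by rewrite exprn_gt0.
rewrite -!pmulrn.
move: (a3.+1%:R)%R (b3.+1%:R)%R (2 ^+ n)%R n3 m3 p2 => A B T A0 B0 T0.
rewrite -[LHS]subr_gt0 -[RHS]subr_gt0.
rewrite -[LHS](pmulr_lgt0 _ (mulr_gt0 (mulr_gt0 A0 B0) T0)).
by congr (0 < _)%R; field; rewrite !gt_eqF.
Qed.

(** The digits are found by quantification with [E2], so decoding a sequence needs no program of its
    own. *)
Lemma plt_digits_ex a b n : plt a b n =
  `[< exists a1, `[< exists a2, `[< exists a3, `[< exists b1, `[< exists b2,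
  `[< exists b3, [&& rat_digits a a1 a2 a3, rat_digits b b1 b2 b3
     & plt_digits a1 a2 a3 b1 b2 b3 n] >] >] >] >] >] >].
Proof.
apply/idP/idP => [ab|].
  have [a1 [a2 [a3 Ha]]] := rat_digits_ex a.
  have [b1 [b2 [b3 Hb]]] := rat_digits_ex b.
  do 6! [apply/asboolP; eexists]; apply/and3P; split; [exact: Ha|exact: Hb|].
  by rewrite -(plt_digitsP _ Ha Hb).
do 6! [move=> /asboolP[?]]; case/and3P => Ha Hb.
by rewrite (plt_digitsP _ Ha Hb).
Qed.

Section RationalDigits.
Variables (E : Type) (phi : E -> seq arg).
Hypothesis HE : has_E2 phi.

Lemma udec_rat_digits (c a b d : E -> nat) :
  ucomp phi c -> ucomp phi a -> ucomp phi b -> ucomp phi d ->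
  udec phi (fun x => rat_digits (c x) (a x) (b x) (d x)).
Proof.
move=> Hc Ha Hb Hd; apply: udec_or.
  by apply: udec_eq => //; apply: ucomp_code3; auto with ctx.
do 3! [apply: udec_and; first by apply: udec_eq => //; exact: ucomp_const].
apply: udec_neg; apply: udec_ex => //=; apply: udec_ex; first by auto with ctx.
apply: udec_ex; first by auto with ctx.
apply: udec_eq; first by uwk Hc.
by apply: ucomp_code3; [auto with ctx | uvar | uvar | uvar].
Qed.

End RationalDigits.

Section Rationals.
Variables (E : Type) (phi : E -> seq arg).
Hypothesis HE : has_E2 phi.

Lemma udec_plt (a b n : E -> nat) :
  ucomp phi a -> ucomp phi b -> ucomp phi n ->
  udec phi (fun x => plt (a x) (b x) (n x)).
Proof.
move=> Ha Hb Hn; apply: (ucomp_let Ha).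
apply: (ucomp_let (a := b)); first by uwk Hb.
apply: (ucomp_let (a := n)); first by uwk Hn.
apply: (@ucomp_ext _ _ _ _ (fun x => congr1 nat_of_bool
  (esym (plt_digits_ex (a x) (b x) (n x))))).
do 6! [apply: udec_ex; first by auto 20 with ctx].
apply: udec_and; last apply: udec_and.
- by apply: udec_rat_digits; [auto 20 with ctx| uvar | uvar | uvar | uvar].
- by apply: udec_rat_digits; [auto 20 with ctx| uvar | uvar | uvar | uvar].
have Hpow : ucomp (push (push (push (push (push (push (plet n (plet b (plet a phi)))))))))
    (fun y => 2 ^ n y.1.1.1.1.1.1).
  apply: (@ucomp_ext _ _ (fun y => 2 ^ n y.1.1.1.1.1.1 * (0).*2.+1)).
    by move=> y; rewrite muln1.
  by apply: ucomp_code_cons; [auto 20 with ctx | uvar | exact: ucomp_const].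
rewrite /plt_digits; apply: udec_leq; repeat first
  [ exact: Hpow | uvar | apply: ucomp_mul; first by auto 20 with ctx
  | apply: ucomp_succ | apply: ucomp_add ].
Qed.
End Rationals.

(** * Predicates on rationals and names, and their decidability *)

Definition qlt (a b : nat) : bool := `[< exists n, ~~ plt b a n >].
(* If [al] names [x], this says [c < x]; the index shift makes it strict. *)
Definition lcut (c : nat) (al : nat -> nat) : bool :=
  `[< exists n, ~~ plt (al n.+1) c n >].
Definition is_name (al : nat -> nat) : bool :=
  `[< forall n, `[< forall i,
    plt (al n) (al (n + i)) n && plt (al (n + i)) (al n) n >] >].

Definition code0 : nat := CodeSeq.code [:: 0; 0; 0].
Definition code1 : nat := CodeSeq.code [:: 1; 0; 0].
Definition codeN1 : nat := CodeSeq.code [:: 0; 1; 0].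

Definition is_name01 (al : nat -> nat) : bool := is_name al && `[< forall c,
  (lcut c al ==> qlt c code1) && (qlt c code0 ==> lcut c al) >].
Definition in01 (c : nat) : bool := ~~ qlt c code0 && ~~ qlt code1 c.
Definition name_lt (al be : nat -> nat) : bool :=
  `[< exists c, ~~ lcut c al && lcut c be >].
(** Two rationals at distance at least [2 ^- k] that separate the reals express a distance strictly
    above [2 ^- k], because [lcut] is strict. *)
Definition apart (k : nat) (al be : nat -> nat) : bool :=
  `[< exists a, `[< exists b, ~~ plt b a k &&
    ((~~ lcut a al && lcut b be) || (~~ lcut a be && lcut b al)) >] >].
(** The distance is measured to an approximation of the real instead of the real. This matches
    closeness up to a shift of [m] by one, which is harmless since [m] is quantified universally. *)
Definition rat_near (m c : nat) (al : nat -> nat) : bool :=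
  plt c (al m.+1) m && plt (al m.+1) c m.
(** Decidable counterpart of [jumps]. The number [n] codes a rational lower bound [p] and a jump
    size [k]; the function is probed at rationals through their constant names. *)
Definition jump_at (G : tot tFun) (n : nat) (al : nat -> nat) : bool :=
  is_name01 al && `[< exists p, `[< exists k,
    [&& n == CodeSeq.code [:: p; k], lcut p al & `[< forall m, `[< exists c,
      [&& rat_near m c al, in01 c & apart k (G al) (G (fun=> c))] >] >]] >] >].

Definition has_fun (E : Type) (phi : E -> seq arg) (G : E -> tot tFun) : Prop :=
  exists i, forall x, onth (phi x) i = Some (targ (G x)).

Lemma has_fun_weak (E E' : Type) k (g : E' -> E) (phi : E -> seq arg)
    (phi' : E' -> seq arg) (G : E -> tot tFun) :
  (forall y, iter k behead (phi' y) = phi (g y)) ->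
  has_fun phi G -> has_fun phi' (fun y => G (g y)).
Proof.
move=> Hk [i Hi]; exists (k + i) => y; rewrite -Hi -Hk.
by elim: k {Hk} (phi' y) => //= k IH [|a s]; rewrite -iterS iterSr -IH /= ?onth0n.
Qed.

Ltac ufn H := first
  [ exact: H
  | apply: (ucomp_fapp (k := 2) _ _ _ H); by [auto 20 with ctx | | uvar]
  | apply: (ucomp_fapp (k := 3) _ _ _ H); by [auto 20 with ctx | | uvar]
  | apply: (ucomp_fapp (k := 4) _ _ _ H); by [auto 20 with ctx | | uvar]
  | apply: (ucomp_fapp (k := 5) _ _ _ H); by [auto 20 with ctx | | uvar]
  | apply: (ucomp_fapp (k := 6) _ _ _ H); by [auto 20 with ctx | | uvar] ].

Section Names.
Variables (E : Type) (phi : E -> seq arg).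
Hypothesis HE : has_E2 phi.

Lemma udec_qlt (a b : E -> nat) : ucomp phi a -> ucomp phi b ->
  udec phi (fun x => qlt (a x) (b x)).
Proof.
move=> Ha Hb; apply: udec_ex => //; apply: udec_neg.
by apply: udec_plt; [auto with ctx | uwk Hb | uwk Ha | uvar].
Qed.

Lemma udec_lcut (c : E -> nat) (al : E -> nat -> nat) :
  ucomp phi c -> ucomp (push phi) (fun y => al y.1 y.2) ->
  udec phi (fun x => lcut (c x) (al x)).
Proof.
move=> Hc Hal; apply: udec_ex => //; apply: udec_neg.
apply: udec_plt; [by auto with ctx | | by uwk Hc | by uvar].
by apply: (ucomp_fapp (k := 1) _ _ _ Hal); [auto with ctx | | | apply: ucomp_succ; uvar].
Qed.
End Names.

Section NamePredicates.
Variables (E : Type) (phi : E -> seq arg) (al : E -> nat -> nat).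
Hypothesis HE : has_E2 phi.
Hypothesis Hal : ucomp (push phi) (fun y => al y.1 y.2).

Lemma udec_is_name : udec phi (fun x => is_name (al x)).
Proof.
do 2! [apply: udec_all; first by auto with ctx].
have H1 : ucomp (push (push phi)) (fun y => al y.1.1 y.1.2).
  by apply: (ucomp_fapp (k := 2) _ _ _ Hal); [auto with ctx | | | uvar].
have H2 : ucomp (push (push phi)) (fun y => al y.1.1 (y.1.2 + y.2)).
  by apply: (ucomp_fapp (k := 2) _ _ _ Hal);
    [auto with ctx | | | apply: ucomp_add; uvar].
by apply: udec_and; apply: udec_plt => //; auto with ctx; uvar.
Qed.

Lemma udec_rat_near (m c : E -> nat) : ucomp phi m -> ucomp phi c ->
  udec phi (fun x => rat_near (m x) (c x) (al x)).
Proof.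
move=> Hm Hc.
have H1 : ucomp phi (fun y => al y (m y).+1).
  apply: (ucomp_fapp (k := 0) (g := id) _ _ _ Hal);
    [by auto with ctx | by [] | by [] | exact: ucomp_succ].
by apply: udec_and; apply: udec_plt.
Qed.
End NamePredicates.

Lemma udec_is_name01 (E : Type) (phi : E -> seq arg) (al : E -> nat -> nat) :
  has_E2 phi -> ucomp (push phi) (fun y => al y.1 y.2) ->
  udec phi (fun x => is_name01 (al x)).
Proof.
move=> HE Hal; apply: udec_and; first exact: udec_is_name.
apply: udec_all => //; have HE' := has_E2_push HE.
have Hcut : udec (push phi) (fun y => lcut y.2 (al y.1)).
  by apply: (udec_lcut _ (al := fun y => al y.1)) => //; [uvar | ufn Hal].
apply: udec_and; apply: udec_imp => //.
- by apply: udec_qlt => //; [uvar | exact: ucomp_const].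
- by apply: udec_qlt => //; [uvar | exact: ucomp_const].
Qed.

Lemma udec_in01 (E : Type) (phi : E -> seq arg) (c : E -> nat) :
  has_E2 phi -> ucomp phi c -> udec phi (fun x => in01 (c x)).
Proof.
by move=> HE Hc; apply: udec_and; apply: udec_neg; apply: udec_qlt => //;
  exact: ucomp_const.
Qed.

Section TwoNames.
Variables (E : Type) (phi : E -> seq arg) (al be : E -> nat -> nat).
Hypothesis HE : has_E2 phi.
Hypothesis Hal : ucomp (push phi) (fun y => al y.1 y.2).
Hypothesis Hbe : ucomp (push phi) (fun y => be y.1 y.2).

Lemma udec_name_lt : udec phi (fun x => name_lt (al x) (be x)).
Proof.
apply: udec_ex => //; have HE' := has_E2_push HE.
apply: udec_and; [apply: udec_neg|].
- by apply: (udec_lcut _ (al := fun y => al y.1)) => //; [uvar | ufn Hal].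
- by apply: (udec_lcut _ (al := fun y => be y.1)) => //; [uvar | ufn Hbe].
Qed.

Lemma udec_apart (k : E -> nat) : ucomp phi k ->
  udec phi (fun x => apart (k x) (al x) (be x)).
Proof.
move=> Hk; do 2! [apply: udec_ex; first by auto with ctx].
have HE' := has_E2_push (has_E2_push HE).
have Ha i : i = 0 \/ i = 1 ->
  udec (push (push phi)) (fun y => lcut (if i == 0 then y.2 else y.1.2) (al y.1.1)).
  case=> -> /=; apply: (udec_lcut _ (al := fun y => al y.1.1)) => //.
  uvar. ufn Hal. uvar. ufn Hal.
have Hb i : i = 0 \/ i = 1 ->
  udec (push (push phi)) (fun y => lcut (if i == 0 then y.2 else y.1.2) (be y.1.1)).
  case=> -> /=; apply: (udec_lcut _ (al := fun y => be y.1.1)) => //.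
  uvar. ufn Hbe. uvar. ufn Hbe.
apply: udec_and.
  by apply: udec_neg; apply: udec_plt => //; [uvar | uvar | uwk Hk].
apply: udec_or; apply: udec_and.
- by apply: udec_neg; apply: (Ha 1); right.
- by apply: (Hb 0); left.
- by apply: udec_neg; apply: (Hb 1); right.
- by apply: (Ha 0); left.
Qed.
End TwoNames.

Lemma udec_jump_at (E : Type) (phi : E -> seq arg) (G : E -> tot tFun)
    (n : E -> nat) (al : E -> nat -> nat) :
  has_E2 phi -> has_fun phi G -> ucomp phi n ->
  ucomp (push phi) (fun y => al y.1 y.2) ->
  udec phi (fun x => jump_at (G x) (n x) (al x)).
Proof.
move=> HE HG Hn Hal; apply: udec_and; first exact: udec_is_name01.
do 2! [apply: udec_ex; first by auto with ctx].
have HE2 := has_E2_push (has_E2_push HE).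
apply: udec_and.
  by apply: udec_eq; [uwk Hn | apply: ucomp_code2; [auto with ctx | uvar | uvar]].
apply: udec_and.
  by apply: (udec_lcut _ (al := fun y => al y.1.1)) => //; [uvar | ufn Hal].
apply: udec_all => //; apply: udec_ex; first by auto with ctx.
have HE4 := has_E2_push (has_E2_push HE2).
apply: udec_and; last apply: udec_and.
- by apply: (udec_rat_near (al := fun y => al y.1.1.1.1)) => //; [ufn Hal | uvar | uvar].
- by apply: udec_in01 => //; uvar.
have [j Hj] : has_fun (push (push (push (push (push phi))))) (fun y => G y.1.1.1.1.1).
  exact: (has_fun_weak (k := 5) _ HG).
apply: (udec_apart (al := fun y => G y.1.1.1.1 (al y.1.1.1.1))
         (be := fun y => G y.1.1.1.1 (fun=> y.2))) => //.
- apply: (ucomp_fun (b := fun y => al y.1.1.1.1.1) Hj); [by ufn Hal | by uvar].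
- apply: (ucomp_fun (b := fun y => fun=> y.1.2) Hj); by uvar.
- by uvar.
Qed.

(** The canonical name of a real with lower cut [L]: entry [j] is the least code in the cut that no
    member of the cut exceeds by [2 ^- j.+1] or more. It depends on the cut alone. The default 0
    never occurs for the cut of a real. *)
Definition least_name (L : nat -> bool) (j : nat) : nat :=
  if pselect (exists c, L c && `[< forall d, L d ==> plt d c j.+1 >]) is left ex
  then ex_minn ex else 0.

Lemma ucomp_least_name (E : Type) (phi : E -> seq arg) (L : E -> nat -> bool)
    (j : E -> nat) :
  has_E2 phi -> udec (push phi) (fun y => L y.1 y.2) -> ucomp phi j ->
  (forall x, exists c, L x c && `[< forall d, L x d ==> plt d c (j x).+1 >]) ->
  ucomp phi (fun x => least_name (L x) (j x)).
Proof.
move=> HE HL Hj Hex.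
apply: (@ucomp_ext _ _ (fun x => ex_minn (Hex x))).
  move=> x; rewrite /least_name; case: pselect => [ex|/(_ (Hex x))//].
  by apply: eq_ex_minn.
apply: ucomp_mu; first by auto with ctx.
apply: udec_and => //; apply: udec_all; first by auto with ctx.
apply: udec_imp.
  apply: (ucomp_fapp (k := 2) (b := fun x d => L x d : nat) _ _ _ HL);
    by [auto with ctx | | uvar].
by apply: udec_plt; [auto with ctx | uvar | uvar | apply: ucomp_succ; uwk Hj].
Qed.

Local Open Scope classical_set_scope.
Local Open Scope ring_scope.

(** * Names of real numbers *)

Section RealNames.
Variable R : realType.
Implicit Types (x y : R) (al be : nat -> nat).

Definition qval (c : nat) : R := ratr (rat_of_code c).

Lemma rat_of_code_surj (r : rat) : exists c, rat_of_code c = r.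
Proof.
have [a [b ab]] : exists a b : nat, numq r = a%:Z - b%:Z.
  case: (numq r) => n; first by exists n, 0%N; rewrite subr0.
  by exists 0%N, n.+1; rewrite sub0r NegzE.
exists (CodeSeq.code [:: a; b; (`|denq r|.-1)%N]).
rewrite /rat_of_code CodeSeq.codeK prednK ?absz_gt0 ?denq_eq0 //.
rewrite absz_denq -[RHS]divq_num_den ab; congr (_ / _).
by rewrite rmorphB.
Qed.

Lemma qval_dense x y : x < y -> exists2 c, x < qval c & qval c < y.
Proof.
move=> /rat_in_itvoo[r]; have [c <-] := rat_of_code_surj r.
by rewrite in_itv /= => /andP[? ?]; exists c.
Qed.

Lemma pltE a b n : plt a b n = (qval a < qval b + 2 ^- n).
Proof.
rewrite /plt /qval -(@ltr_rat R) rmorphD /= fmorphV rmorphXn /=.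
by rewrite ratr_nat.
Qed.

Lemma pow2V_lt (e : R) : 0 < e -> exists n, 2 ^- n < e.
Proof.
move=> e0; have [n _ Hn] := near_infty_natSinv_expn_lt (PosNum e0).
by exists n; have := Hn n (leqnn n); rewrite /= div1r.
Qed.

Lemma qltE a b : qlt a b = (qval a < qval b).
Proof.
apply/asboolP/idP => [[n]|ab].
  rewrite pltE -leNgt; apply: lt_le_trans.
  by rewrite ltrDl invr_gt0 exprn_gt0.
have [n nab] : exists n, 2 ^- n < qval b - qval a.
  by apply: pow2V_lt; rewrite subr_gt0.
by exists n; rewrite pltE -leNgt; lra.
Qed.

Lemma names_dist al x n : names_real al x -> `|qval (al n) - x| <= 2 ^- n.
Proof.
move=> [ca cx]; apply/ler_addgt0Pr => e e0.
have [N _ HN] := (@cvgrPdist_lt _ _ _ _ _ _ _).1 cx e e0.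
have := HN (n + N)%N (leq_addl _ _); rewrite distrC => H.
have := ca n N; rewrite -(@ltr_rat R) ratr_norm rmorphB /= fmorphV rmorphXn /= ratr_nat.
rewrite -/(qval _) -/(qval _) => H'.
rewrite -(subrKA (qval (al (n + N)))).
by rewrite (le_trans (ler_normD _ _)) // lerD // ltW.
Qed.

Lemma names_realP al x :
  (forall n i : nat, `|rat_of_code (al n) - rat_of_code (al (n + i)%N)| < 2 ^- n) ->
  (forall n, `|qval (al n) - x| <= 2 ^- n) -> names_real al x.
Proof.
move=> ca dx; split=> //; apply/cvgrPdist_lt => e e0.
have [N HN] := pow2V_lt e0; exists N => // n /= Nn.
rewrite distrC; apply: le_lt_trans (dx n) (le_lt_trans _ HN).
by rewrite lef_pV2 ?posrE ?exprn_gt0 // ler_eXn2l ?ltr1n.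
Qed.

Lemma names_real_inj al x y : names_real al x -> names_real al y -> x = y.
Proof. by move=> [_ cx] [_ cy]; apply: (cvg_unique _ cx cy). Qed.

Lemma names_qval c : names_real (fun=> c) (qval c).
Proof.
split=> [n i|]; last exact: cvg_cst.
by rewrite subrr normr0 invr_gt0 exprn_gt0.
Qed.

Lemma lcutE al x c : names_real al x -> lcut c al = (qval c < x).
Proof.
move=> alx; have D := names_dist _ alx.
apply/asboolP/idP => [[n]|cx].
  rewrite pltE -leNgt => H; have := D n.+1; rewrite ler_distl => /andP[H1 H2].
  have : 2 ^- n.+1 < 2 ^- n :> R.
    by rewrite ltf_pV2 ?posrE ?exprn_gt0 // ltr_eXn2l ?ltr1n.
  lra.
have [n Hn] : exists n, 2 ^- n < (x - qval c) / 2.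
  by apply: pow2V_lt; rewrite divr_gt0 // subr_gt0.
exists n; rewrite pltE -leNgt; have := D n.+1.
have : 2 ^- n.+1 < 2 ^- n :> R.
  by rewrite ltf_pV2 ?posrE ?exprn_gt0 // ltr_eXn2l ?ltr1n.
by rewrite ler_distl => ? /andP[]; lra.
Qed.

Lemma plt_dist a b n : (plt a b n && plt b a n) =
  (`|rat_of_code a - rat_of_code b| < 2 ^- n).
Proof. by rewrite /plt ltr_distl ltrBlDr andbC. Qed.

(** Completeness: the limit is the supremum of the lower bounds [qval (al n) - 2 ^- n], each of
    which lies below every [qval (al m) + 2 ^- m]. *)
Lemma is_nameP al : reflect (exists x : R, names_real al x) (is_name al).
Proof.
apply: (iffP idP) => [|[x [ca _]]]; last first.
  apply/asboolP => n; apply/asboolP => i; rewrite plt_dist; exact: ca.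
move=> H; have ca n i : `|rat_of_code (al n) - rat_of_code (al (n + i)%N)| < 2 ^- n.
  by rewrite -plt_dist; move/asboolP : H => /(_ n)/asboolP.
have caR n i : `|qval (al n) - qval (al (n + i)%N)| < 2 ^- n.
  have := ca n i; rewrite -(@ltr_rat R) ratr_norm rmorphB /= fmorphV rmorphXn /=.
  by rewrite ratr_nat.
pose A := [set qval (al n) - 2 ^- n | n in setT].
have UA n : ubound A (qval (al n) + 2 ^- n).
  move=> _ [m _ <-].
  have [nm|mn] := leqP n m.
    have := caR n (m - n)%N; rewrite subnKC // ltr_distl => /andP[H1 H2].
    have : 0 < 2 ^- m :> R by rewrite invr_gt0 exprn_gt0.
    lra.
  have := caR m (n - m)%N; rewrite (subnKC (ltnW mn)) ltr_distl => /andP[H1 H2].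
  have : 0 < 2 ^- n :> R by rewrite invr_gt0 exprn_gt0.
  lra.
have A0 : A !=set0 by exists (qval (al 0%N) - 2 ^- 0); exists 0%N.
have sA : has_sup A by split => //; exists (qval (al 0%N) + 2 ^- 0).
exists (sup A); apply: names_realP => // n; rewrite ler_distlC; apply/andP; split.
  by apply: sup_upper_bound => //; exists n.
exact: sup_le_ub.
Qed.

Lemma qval0 : qval code0 = 0.
Proof.
by rewrite /qval /code0 /rat_of_code CodeSeq.codeK subrr mul0r rmorph0.
Qed.

Lemma qval1 : qval code1 = 1.
Proof.
by rewrite /qval /code1 /rat_of_code CodeSeq.codeK subr0 divr1 rmorph1.
Qed.

Lemma qvalN1 : qval codeN1 = -1.
Proof.
by rewrite /qval /codeN1 /rat_of_code CodeSeq.codeK sub0r divr1 rmorphN rmorph1.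
Qed.

Lemma in01E c : in01 c = (qval c \in `[0, 1]).
Proof. by rewrite /in01 !qltE qval0 qval1 -!leNgt in_itv. Qed.

Lemma is_name01P al :
  reflect (exists2 x : R, x \in `[0, 1] & names_real al x) (is_name01 al).
Proof.
apply: (iffP andP) => [[/is_nameP[x alx] /asboolP H]|[x x01 alx]].
  exists x => //; rewrite in_itv /=; apply/andP; split; rewrite leNgt; apply/negP.
    move=> /qval_dense[c xc c0]; have /andP[_] := H c.
    by rewrite qltE qval0 c0 (lcutE _ alx) /= ltNge ltW.
  move=> /qval_dense[c c1 cx]; have /andP[+ _] := H c.
  by rewrite qltE qval1 (lcutE _ alx) cx /= ltNge ltW.
split; first by apply/is_nameP; exists x.
move: x01; rewrite in_itv /= => /andP[x0 x1].
apply/asboolP => c; rewrite (lcutE _ alx) !qltE qval0 qval1.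
apply/andP; split; apply/implyP => ?; first exact: lt_le_trans x1.
exact: lt_le_trans x0.
Qed.

Lemma name_ltE al be x y : names_real al x -> names_real be y ->
  name_lt al be = (x < y).
Proof.
move=> alx bey; apply/asboolP/idP => [[c]|].
  by rewrite (lcutE _ alx) (lcutE _ bey) -leNgt => /andP[]; apply: le_lt_trans.
move=> /qval_dense[c xc cy]; exists c.
by rewrite (lcutE _ alx) (lcutE _ bey) -leNgt ltW.
Qed.

Lemma apartE k al be x y : names_real al x -> names_real be y ->
  apart k al be = (2 ^- k < `|x - y|).
Proof.
move=> alx bey; apply/asboolP/idP.
  move=> [a /asboolP[b]]; rewrite !(lcutE _ alx) !(lcutE _ bey) pltE -!leNgt.
  rewrite ltr_normr => /andP[H /orP[/andP[H1 H2]|/andP[H1 H2]]]; apply/orP.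
    by right; lra.
  by left; lra.
rewrite ltr_normr => /orP[H|H].
  (* Placing [b] strictly above [y + 2 ^- k] leaves room for [a] between [y] and [b - 2 ^- k]. *)
  have [|b yb bx] := @qval_dense (y + 2 ^- k) x; first lra.
  have [|a ya ab] := @qval_dense y (qval b - 2 ^- k); first lra.
  exists a; apply/asboolP; exists b.
  rewrite !(lcutE _ alx) !(lcutE _ bey) pltE -!leNgt (ltW ya) bx orbT andbT.
  lra.
have [|b yb bx] := @qval_dense (x + 2 ^- k) y; first lra.
have [|a ya ab] := @qval_dense x (qval b - 2 ^- k); first lra.
exists a; apply/asboolP; exists b.
rewrite !(lcutE _ alx) !(lcutE _ bey) pltE -!leNgt (ltW ya) bx /= andbT.
lra.
Qed.

Lemma rat_nearW m c al x : names_real al x -> rat_near m.+1 c al ->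
  `|qval c - x| < 2 ^- m.
Proof.
move=> alx; have := names_dist m.+2 alx.
rewrite /rat_near !pltE ler_distl => /andP[H1 H2] /andP[H3 H4].
have E1 : 2 ^- m = 2 ^- m.+1 * 2 :> R by rewrite exprS; field; rewrite expf_neq0.
have E2 : 2 ^- m.+1 = 2 ^- m.+2 * 2 :> R.
  by rewrite [in RHS]exprS; field; rewrite expf_neq0.
have E3 : 0 < 2 ^- m.+2 :> R by rewrite invr_gt0 exprn_gt0.
rewrite ltr_distl; lra.
Qed.

Lemma near_rat m c al x : names_real al x -> `|qval c - x| < 2 ^- m.+1 ->
  rat_near m c al.
Proof.
move=> alx; have := names_dist m.+1 alx.
rewrite /rat_near !pltE ler_distl ltr_distl => /andP[H1 H2] /andP[H3 H4].
have E1 : 2 ^- m = 2 ^- m.+1 * 2 :> R by rewrite exprS; field; rewrite expf_neq0.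
lra.
Qed.

Section LeastName.
Variables (L : nat -> bool) (x : R).
Hypothesis HL : forall c, L c = (qval c < x).

(** By density of the rationals, no member of the cut exceeds [c] by [2 ^- j.+1] or more exactly
    when [c] is within [2 ^- j.+1] of the supremum [x]. *)
Lemma lower_approxE j c :
  L c && `[< forall d, L d ==> plt d c j.+1 >] = (x - 2 ^- j.+1 <= qval c < x).
Proof.
rewrite HL andbC; congr andb; apply/asboolP/idP => [H|H d]; last first.
  rewrite HL pltE; apply/implyP; lra.
rewrite leNgt; apply/negP; rewrite ltrBrDr => /qval_dense[d cd dx].
by have := H d; rewrite HL dx pltE /= ltNge ltW.
Qed.

Lemma lower_approx_ex j :
  exists c, L c && `[< forall d, L d ==> plt d c j.+1 >].
Proof.
have [|c xc cx] := @qval_dense (x - 2 ^- j.+1) x.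
  by rewrite ltrBlDr ltrDl invr_gt0 exprn_gt0.
by exists c; rewrite lower_approxE cx ltW.
Qed.

Lemma names_least_name : names_real (least_name L) x.
Proof.
have H j : x - 2 ^- j.+1 <= qval (least_name L j) < x.
  rewrite -lower_approxE /least_name; case: pselect => [ex|/(_ (lower_approx_ex j))//].
  by case: ex_minnP.
have E1 m : 2 ^- m = 2 ^- m.+1 * 2 :> R by rewrite exprS; field; rewrite expf_neq0.
have P m : 0 < 2 ^- m :> R by rewrite invr_gt0 exprn_gt0.
apply: names_realP => [n i|n]; last first.
  have /andP[H1 H2] := H n; rewrite ler_distl; apply/andP.
  by have := E1 n; have := P n.+1; lra.
rewrite -(@ltr_rat R) ratr_norm rmorphB /= fmorphV rmorphXn /= ratr_nat.
rewrite -/(qval _) -/(qval _).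
have /andP[H1 H2] := H n; have /andP[H3 H4] := H (n + i)%N.
have : 2 ^- (n + i).+1 <= 2 ^- n.+1 :> R.
  by rewrite lef_pV2 ?posrE ?exprn_gt0 // ler_eXn2l ?ltr1n // ltnS leq_addr.
by have := E1 n; have := P n.+1; rewrite ltr_distl; lra.
Qed.

End LeastName.

Lemma exists_name x : exists al, names_real al x.
Proof.
exists (least_name (fun c => qval c < x)); exact: names_least_name.
Qed.

(** Only rational points are compared with [x], which makes the condition decidable by [E2]. A
    rational [c] equal to [x] never satisfies the last clause. *)
Definition jump_set (f : R -> R) (k : nat) : set R :=
  [set x | x \in `[0, 1] /\ forall m : nat, exists c,
    [/\ qval c \in `[0, 1], `|qval c - x| < 2 ^- m & 2 ^- k < `|f (qval c) - f x| ] ].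

(** Both parameters are packed in one number, over which the enumeration will run. The set is empty
    if [n] does not code a pair. *)
Definition jumps (f : R -> R) (n : nat) : set R := [set x |
  exists p k : nat, [/\ n = CodeSeq.code [:: p; k], qval p < x & jump_set f k x] ].

Lemma jump_atP (G : tot tFun) f n al : names_fun G f ->
  reflect (exists2 x : R, names_real al x & jumps f n x) (jump_at G n al).
Proof.
move=> Gf; apply: (iffP andP).
  move=> [/is_name01P[x x01 alx] /asboolP[p /asboolP[k]]].
  rewrite (lcutE _ alx) => /and3P[/eqP nE px /asboolP H].
  exists x => //; exists p, k; split => //; split => // m.
  (* The index is shifted because [rat_near] controls the distance to [x] only up to a factor 2. *)
  have /asboolP[c] := H m.+1; rewrite in01E => /and3P[mc c01].
  rewrite (apartE _ (Gf _ _ x01 alx) (Gf _ _ c01 (names_qval c))) distrC => Hk.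
  by exists c; split => //; apply: rat_nearW alx mc.
move=> [x alx [p [k [nE px [x01 H]]]]]; split; first by apply/is_name01P; exists x.
apply/asboolP; exists p; apply/asboolP; exists k.
rewrite nE eqxx (lcutE _ alx) px /=; apply/asboolP => m; apply/asboolP.
have [c [c01 cx Hk]] := H m.+1; exists c.
rewrite (near_rat alx cx) in01E c01 /=.
by rewrite (apartE _ (Gf _ _ x01 alx) (Gf _ _ c01 (names_qval c))) distrC.
Qed.

Lemma names_fun_inj (F : tot tFun) (f g : R -> R) : names_fun F f -> names_fun F g ->
  {in `[0, 1], f =1 g}.
Proof.
move=> Ff Fg x x01; have [al alx] := exists_name x.
exact: names_real_inj (Ff _ _ x01 alx) (Fg _ _ x01 alx).
Qed.
End RealNames.

(** * Jumps of functions of bounded variation *)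

Section BoundedVariation.
Variable R : realType.
Implicit Types (f g h : R -> R) (x y z e : R).

(** The values to the right of [y] are bounded below by their infimum; for [x0] where [g] nearly
    attains it, all values between [y] and [x0] lie in an interval shorter than [e]. *)
Lemma nondecreasing_osc_right g y e : {in `[0, 1] &, {homo g : u v / u <= v}} ->
  0 <= y -> 0 < e -> exists2 z, y < z & forall a b, a \in `[0, 1] -> b \in `[0, 1] ->
    y < a < z -> y < b < z -> `|g a - g b| < e.
Proof.
move=> gh y0 e0; have [y1|y1] := leP 1 y.
  exists (y + 1); first by rewrite ltrDl.
  move=> a b; rewrite in_itv /= => /andP[_ a1] _ /andP[ya _].
  by have := lt_le_trans ya a1; rewrite ltNge y1.
pose S := [set g a | a in [set a | y < a <= 1]].
have in01 a : y < a <= 1 -> a \in `[0, 1].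
  by rewrite in_itv /= => /andP[ya ->]; rewrite (le_trans y0 (ltW ya)).
have Slb : lbound S (g y).
  move=> _ [a ya <-]; apply: gh; [| exact: in01 | by case/andP: ya => /ltW].
  by rewrite in_itv /= y0 ltW.
have Sinf : has_inf S.
  by split; [exists (g 1); exists 1 => //; rewrite /= y1 /= | exists (g y)].
have [_ [x0 yx0 <-] Hx0] := inf_adherent e0 Sinf.
have [yx x1] := andP yx0.
exists x0 => // a b a01 b01 /andP[ya ax] /andP[yb bx].
have inS c : c \in `[0, 1] -> y < c -> c < x0 -> inf S <= g c /\ g c <= g x0.
  move=> c01 yc cx; split; last by apply: gh => //; [exact: in01 | exact: ltW].
  apply: (ge_inf (proj2 Sinf)); exists c => //=; rewrite yc /=.
  by move: c01; rewrite in_itv => /andP[].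
have [A1 A2] := inS a a01 ya ax; have [B1 B2] := inS b b01 yb bx.
rewrite ltr_distl; lra.
Qed.

(** Reduced to the right-hand case by the reflection [x] to [1 - x] and a change of sign. *)
Lemma nondecreasing_osc_left g y e : {in `[0, 1] &, {homo g : u v / u <= v}} ->
  y <= 1 -> 0 < e -> exists2 z, z < y & forall a b, a \in `[0, 1] -> b \in `[0, 1] ->
    z < a < y -> z < b < y -> `|g a - g b| < e.
Proof.
move=> gh y1 e0; pose h x := - g (1 - x).
have hh : {in `[0, 1] &, {homo h : u v / u <= v}}.
  move=> u v; rewrite !in_itv /= => /andP[u0 u1] /andP[v0 v1] uv.
  by rewrite lerN2; apply: gh; rewrite ?in_itv /=; lra.
have [|z yz Hz] := @nondecreasing_osc_right h (1 - y) e hh _ e0; first lra.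
exists (1 - z); first lra.
move=> a b; rewrite !in_itv /= => a01 b01 ya yb.
have := Hz (1 - a) (1 - b); rewrite !in_itv /h /= !subKr => H.
rewrite -normrN (_ : - (g a - g b) = - g a - - g b); last by ring.
apply: H; lra.
Qed.

(** Jordan decomposition into positive and negative variation. *)
Lemma BV_decomposition f : bounded_variation 0 1 f ->
  exists g h, [/\ {in `[0, 1] &, {homo g : u v / u <= v}},
    {in `[0, 1] &, {homo h : u v / u <= v}} & {in `[0, 1], f =1 g \- h}].
Proof.
move=> bf; exists (fine \o pos_tv 0 f), (fine \o neg_tv 0 f); split.
- exact/fine_neg_tv_nondecreasing/bounded_variationN.
- exact: fine_neg_tv_nondecreasing.
- exact: bounded_variation_pos_neg_tvE.
Qed.

Lemma BV_osc_right f y e : bounded_variation 0 1 f -> 0 <= y -> 0 < e ->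
  exists2 z, y < z & forall a b, a \in `[0, 1] -> b \in `[0, 1] ->
    y < a < z -> y < b < z -> `|f a - f b| < e.
Proof.
move=> /BV_decomposition[g [h [gm hm fE]]] y0 e0.
have e2 : 0 < e / 2 by rewrite divr_gt0.
have [z1 yz1 H1] := nondecreasing_osc_right gm y0 e2.
have [z2 yz2 H2] := nondecreasing_osc_right hm y0 e2.
exists (Num.min z1 z2); first by rewrite lt_min yz1.
move=> a b a01 b01; rewrite !lt_min => /and3P[ya a1 a2] /and3P[yb b1 b2].
have := H1 a b a01 b01; rewrite ya a1 yb b1 => /(_ isT isT).
have := H2 a b a01 b01; rewrite ya a2 yb b2 => /(_ isT isT).
by rewrite !fE //= !ltr_distl => /andP[? ?] /andP[? ?]; lra.
Qed.

Lemma BV_osc_left f y e : bounded_variation 0 1 f -> y <= 1 -> 0 < e ->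
  exists2 z, z < y & forall a b, a \in `[0, 1] -> b \in `[0, 1] ->
    z < a < y -> z < b < y -> `|f a - f b| < e.
Proof.
move=> /BV_decomposition[g [h [gm hm fE]]] y0 e0.
have e2 : 0 < e / 2 by rewrite divr_gt0.
have [z1 yz1 H1] := nondecreasing_osc_left gm y0 e2.
have [z2 yz2 H2] := nondecreasing_osc_left hm y0 e2.
exists (Num.max z1 z2); first by rewrite gt_max yz1.
move=> a b a01 b01; rewrite !gt_max => /andP[/andP[ya a1] a2] /andP[/andP[yb b1] b2].
have := H1 a b a01 b01; rewrite ya a2 yb b2 => /(_ isT isT).
have := H2 a b a01 b01; rewrite a1 a2 b1 b2 => /(_ isT isT).
by rewrite !fE //= !ltr_distl => /andP[? ?] /andP[? ?]; lra.
Qed.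

Lemma BV_has_sup f : bounded_variation 0 1 f -> has_sup (f @` `[0, 1]).
Proof.
move=> /BV_decomposition[g [h [gm hm fE]]]; split.
  by exists (f 0), 0 => //=; rewrite in_itv /= lexx ler01.
have I0 : (0 : R) \in `[0, 1] by rewrite in_itv /= lexx ler01.
have I1 : (1 : R) \in `[0, 1] by rewrite in_itv /= lexx ler01.
exists (g 1 - h 0) => _ [x x01 <-].
have x01' : x \in `[0, 1] by [].
rewrite fE //= lerB //; [apply: gm | apply: hm] => //;
  by move: x01'; rewrite in_itv => /andP[].
Qed.

(** Opposes the oscillation bounds: an open interval on which [f] oscillates by less than [2 ^- k]
    contains no point of [jump_set f k]. *)
Lemma no_jump_of_osc f k a b x : a < x < b -> jump_set f k x ->
  exists2 y, y \in `[0, 1] /\ a < y < b & 2 ^- k < `|f y - f x|.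
Proof.
move=> /andP[ax xb] [x01 Hx].
have [m Hm] : exists m, 2 ^- m < Num.min (x - a) (b - x).
  by apply: pow2V_lt; rewrite lt_min !subr_gt0 ax.
have [c [c01 cx ck]] := Hx m; exists (qval R c) => //; split => //.
by move: cx Hm; rewrite lt_min ltr_distl => /andP[? ?] /andP[? ?]; lra.
Qed.

(** If the infimum of [S] were not attained, points of [S] would lie arbitrarily close to its right,
    where [f] oscillates by less than [2 ^- k]. *)
Lemma jumps_has_min f n (S : set R) : bounded_variation 0 1 f ->
  S `<=` jumps f n -> S !=set0 -> exists2 x, S x & forall y, S y -> x <= y.
Proof.
move=> bf SJ S0; have [s0 Ss0] := S0.
have [p [k [nE _ _]]] := SJ _ Ss0.
(* The coding is injective, so all points of [S] share the same [k]. *)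
have S01 s : S s -> jump_set f k s.
  move=> /SJ[p' [k' [nE' _]]].
  by move: nE'; rewrite nE => /(can_inj CodeSeq.codeK)[_ ->].
have lb0 : lbound S 0.
  by move=> s /S01[+ _]; rewrite in_itv => /andP[].
have Sinf : has_inf S by split => //; exists 0.
have y0 : 0 <= inf S by apply: lb_le_inf.
have e0 : 0 < 2 ^- k :> R by rewrite invr_gt0 exprn_gt0.
have [z yz Hz] := BV_osc_right bf y0 e0.
have [s Ss sz] := inf_adherent (eps := z - inf S) (ltac:(lra)) Sinf.
have ys : inf S <= s by apply: (ge_inf (proj2 Sinf)).
move: ys; rewrite le_eqVlt => /predU1P[ys|ys].
  by exists s => // y Sy; rewrite -ys; apply: (ge_inf (proj2 Sinf)).
have ysz : inf S < s < z by lra.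
have [y [y01 yy] Hy] := no_jump_of_osc ysz (S01 _ Ss).
have := Hz y s y01 (proj1 (S01 _ Ss)) yy ysz.
by rewrite ltNge ltW.
Qed.

(** Left of [x] there is an interval on which [f] oscillates by less than [2 ^- k]; any rational [p]
    in it separates [x] from the smaller jumps of that size. *)
Lemma jump_set_isolated f k x : bounded_variation 0 1 f -> jump_set f k x ->
  exists2 p, jumps f (CodeSeq.code [:: p; k]) x &
    forall y, jumps f (CodeSeq.code [:: p; k]) y -> x <= y.
Proof.
move=> bf jx; have [x01 _] := jx.
have e0 : 0 < 2 ^- k :> R by rewrite invr_gt0 exprn_gt0.
have x1 : x <= 1 by move: x01; rewrite in_itv => /andP[].
have [z zx Hz] := BV_osc_left bf x1 e0.
have [p zp px] := qval_dense zx.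
exists p; first by exists p, k.
move=> y [p' [k' [/(can_inj CodeSeq.codeK)[<- <-] py jy]]].
rewrite leNgt; apply/negP => yx.
have yzx : z < y < x by rewrite yx (lt_trans zp).
have [u [u01 uzx] Hu] := no_jump_of_osc yzx jy.
have := Hz u y u01 (proj1 jy) uzx yzx.
by rewrite ltNge ltW.
Qed.

(** The absence of a jump bounds [f] only at rationals near [x]. The one-sided oscillation bounds
    carry this over to any [y], through a rational between [y] and [x]. *)
Lemma not_jump_continuous f x e : bounded_variation 0 1 f -> x \in `[0, 1] ->
  (forall k, ~ jump_set f k x) -> 0 < e ->
  exists2 d, 0 < d & forall y, y \in `[0, 1] -> `|y - x| < d -> `|f y - f x| < e.
Proof.
move=> bf x01 nj e0; have /andP[x0 x1] : 0 <= x <= 1 by move: x01; rewrite in_itv.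
have e2 : 0 < e / 2 by rewrite divr_gt0.
have [k Hk] := pow2V_lt e2.
have [m Hm] : exists m, forall c, qval R c \in `[0, 1] -> `|qval R c - x| < 2 ^- m ->
    `|f (qval R c) - f x| <= 2 ^- k.
  apply: contrapT => H; apply: (nj k); split => // m; apply: contrapT => H'.
  apply: H; exists m => c c01 cx; rewrite leNgt; apply/negP => ck.
  by apply: H'; exists c.
have [z1 xz1 H1] := BV_osc_right bf x0 e2.
have [z2 z2x H2] := BV_osc_left bf x1 e2.
have m0 : 0 < 2 ^- m :> R by rewrite invr_gt0 exprn_gt0.
exists (Num.min (2 ^- m) (Num.min (z1 - x) (x - z2))).
  by rewrite !lt_min m0 !subr_gt0 xz1.
move=> y y01; have /andP[y0 y1] : 0 <= y <= 1 by move: y01; rewrite in_itv.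
rewrite !lt_min => /and3P[D1 D2 D3]; rewrite !ltr_distl in D1 D2 D3.
have [? ?] := andP D1; have [? ?] := andP D2; have [? ?] := andP D3.
have Hmid c : qval R c \in `[0, 1] -> `|f y - f (qval R c)| < e / 2 ->
    `|qval R c - x| < 2 ^- m -> `|f y - f x| < e.
  move=> c01 yc cx; have := Hm c c01 cx.
  by move: yc; rewrite ler_distl !ltr_distl => /andP[? ?] /andP[? ?]; lra.
have [yx|xy|->] := ltgtP y x; last by rewrite subrr normr0.
  have [c yc cx] := qval_dense yx.
  have c01 : qval R c \in `[0, 1] by rewrite in_itv /=; lra.
  apply: (Hmid c) => //; last by rewrite ltr_distl; lra.
  by apply: H2 => //; lra.
have [c yc cx] := qval_dense xy.
have c01 : qval R c \in `[0, 1] by rewrite in_itv /=; lra.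
apply: (Hmid c) => //; last by rewrite ltr_distl; lra.
by apply: H1 => //; lra.
Qed.

Lemma discontinuitiesE f : bounded_variation 0 1 f ->
  discontinuities f = [set x | exists k, jump_set f k x].
Proof.
move=> bf; apply/seteqP; split => x /=.
  move=> [x01 nc]; apply: contrapT => nj; apply: nc.
  apply/cvgrPdist_lt => e e0.
  have [|d d0 Hd] := @not_jump_continuous f x e bf x01 _ e0.
    by move=> k jk; apply: nj; exists k.
  apply/nbhs_ballP; exists d => // y /=; rewrite /ball /= distrC => yx y01.
  by rewrite distrC; apply: Hd.
move=> [k [x01 H]]; split => // fc.
have e0 : 0 < 2 ^- k :> R by rewrite invr_gt0 exprn_gt0.
move/cvgrPdist_lt : fc => /(_ _ e0)/nbhs_ballP[d /= d0 Hd].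
have [m Hm] := pow2V_lt d0.
have [c [c01 cx ck]] := H m.
have := Hd (qval R c); rewrite /ball /= distrC => /(_ (lt_trans cx Hm) c01).
by rewrite distrC ltNge ltW.
Qed.

(** A point where [f] exceeds [r] is either a jump, hence least for a suitable [n], or a point of
    continuity, near which some rational also has a value above [r]. *)
Lemma lt_sup_witness f r : bounded_variation 0 1 f -> r < sup (f @` `[0, 1]) ->
  (exists2 c, qval R c \in `[0, 1] & r < f (qval R c)) \/
  (exists n x, [/\ jumps f n x, (forall y, jumps f n y -> x <= y) & r < f x]).
Proof.
move=> bf rs; have fs := BV_has_sup bf.
have [_ [x x01 <-]] := sup_adherent (eps := sup (f @` `[0, 1]) - r) (ltac:(lra)) fs.
rewrite subKr => rx; have x01' : x \in `[0, 1] by [].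
have [[k jk]|nj] := pselect (exists k, jump_set f k x).
  right; have [p jp xmin] := jump_set_isolated bf jk.
  by exists (CodeSeq.code [:: p; k]), x.
have nj' k : ~ jump_set f k x by move=> jk; apply: nj; exists k.
have e0 : 0 < f x - r by lra.
left; have [d d0 Hd] := not_jump_continuous bf x01' nj' e0.
have /andP[x0 x1] : 0 <= x <= 1 by move: x01'; rewrite in_itv.
have [c [c01 cx]] : exists c, qval R c \in `[0, 1] /\ `|qval R c - x| < d.
  have [xlt|xge] := ltP x 1.
    have [|c xc] := @qval_dense R x (Num.min 1 (x + d)).
      by rewrite lt_min xlt ltrDl.
    rewrite lt_min => /andP[? ?]; exists c.
    by rewrite in_itv ltr_distl /=; lra.
  have [|c] := @qval_dense R (Num.max 0 (x - d)) x.
    by rewrite gt_max ltrBlDr ltrDl d0 andbT; lra.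
  rewrite gt_max => /andP[? ?] ?; exists c.
  by rewrite in_itv ltr_distl /=; lra.
by exists c => //; have := Hd _ c01 cx; rewrite ltr_distl => /andP[? ?]; lra.
Qed.

End BoundedVariation.

(** * Finding the least jump with Omega *)

Section OmegaProgram.
Variable R : realType.
Implicit Types (f : R -> R) (X : set R).

Definition least_jump f (n : nat) : set R :=
  [set x | jumps f n x /\ forall y, jumps f n y -> x <= y].

(** Oracles take total arguments only, so sequences that name no real get the value 0. *)
Definition charfun X : tot tSet := fun z => `[< exists2 x, names_real z x & X x >].

Lemma charfunE X z x : names_real z x -> charfun X z = `[< X x >].
Proof.
move=> zx; rewrite /charfun; congr nat_of_bool; apply/asboolP/asboolP.
  by move=> [y zy]; rewrite (names_real_inj zx zy).
by move=> Xx; exists x.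
Qed.

Lemma least_jump_sub01 f n : least_jump f n `<=` `[0, 1].
Proof. by move=> x [[p [k [_ _ []]]]]. Qed.

Lemma least_jump_subset1 f n : is_subset1 (least_jump f n).
Proof.
move=> x y [jx mx] [jy my]; apply/eqP; rewrite eq_le.
by rewrite mx ?my.
Qed.

Variable Om : pfun (tSet ⇒ tSeq).
Hypothesis HOm : is_Omega R Om.

(** Row 0 of the output holds the length, hence [i.+1]. Rows beyond the length are unspecified, and
    so is what the others name outside [X]: every row has to be tested before use. *)
Definition Om_seq X (i j : nat) : nat := odflt 0%N (Om (charfun X, (i.+1, (j, tt)))).

Lemma Om_seqP X : X `<=` `[0, 1] -> is_subset1 X ->
  (forall i j, Om (charfun X, (i.+1, (j, tt))) = Some (Om_seq X i j)) /\
  (forall x, X x -> exists i, names_real (Om_seq X i) x).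
Proof.
move=> X01 X1; have [perf _] := HOm.
have nX : @task_name (Omega_task R) (charfun X) X.
  by split => // al x _; apply: charfunE.
have [s [w [_ sw] wX] Hs] := perf _ _ nX.
have E i j : Om (charfun X, (i.+1, (j, tt))) = Some (s i.+1 j) by rewrite Hs.
have F i : Om_seq X i = s i.+1 by apply/funext => j; rewrite /Om_seq E.
split=> [i j|x Xx]; first by rewrite E F.
exists (index x w); rewrite F.
have xw := wX _ Xx.
by have := sw (index x w); rewrite index_mem xw nth_index //; apply.
Qed.

Definition below f (n : nat) (z : nat -> nat) : set R :=
  [set y | least_jump f n y /\ exists2 x, names_real z x & y < x].

Lemma below_sub01 f n z : below f n z `<=` `[0, 1].
Proof. by move=> y [/least_jump_sub01]. Qed.

Lemma below_subset1 f n z : is_subset1 (below f n z).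
Proof. by move=> x y [mx _] [my _]; apply: least_jump_subset1 mx my. Qed.

(* Membership in [least_jump] is decided by querying [Om] on a set with at most one
   element: if [jumps f n] has a point below the one named by [z], then its
   least such point is the only element of [below f n z] and occurs in the
   output. *)
Lemma charfun_least_jump (G : tot tFun) f n z :
  names_fun G f -> bounded_variation 0 1 f ->
  charfun (least_jump f n) z = (jump_at G n z && ~~ `[< exists i,
    jump_at G n (Om_seq (below f n z) i) && name_lt (Om_seq (below f n z) i) z >]).
Proof.
move=> Gf bf; congr nat_of_bool; apply/asboolP/andP.
  move=> [x zx [jx mx]]; split; first by apply/jump_atP; [exact: Gf | exists x].
  apply/asboolP => -[i /andP[/(jump_atP _ _ Gf)[y iy jy]]].
  by rewrite (name_ltE iy zx) ltNge mx.
move=> [/(jump_atP _ _ Gf)[x zx jx] /asboolP H]; exists x => //; split => // y jy.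
rewrite leNgt; apply/negP => yx; apply: H.
have [m jm my] := jumps_has_min bf (@subset_refl _ (jumps f n)) (ex_intro _ y jy).
have mm : below f n z m.
  by split; [split | exists x => //; exact: le_lt_trans (my _ jy) yx].
have [_ /(_ _ mm)[i im]] := Om_seqP (@below_sub01 f n z) (@below_subset1 f n z).
exists i; apply/andP; split; first by apply/jump_atP; [exact: Gf | exists m].
by rewrite (name_ltE im zx); exact: le_lt_trans (my _ jy) yx.
Qed.

Definition BVname := {t : tot tFun * (R -> R) |
  names_fun t.1 t.2 /\ bounded_variation 0 1 t.2}.

Definition base (t : BVname) : seq arg :=
  [:: targ (sval t).1; parg Om; targ E2].

(** The first argument [m] is meant to be the index of the program itself, which is how it calls
    itself. *)
Definition rec_ctx (m n : nat) (z : nat -> nat) (t : BVname) : seq arg :=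
  [:: num m, targ (z : tot tReal), num n & base t].

(* The induction hypothesis in the environment says that [env_m] is correct at the
   jumps below the point named by [env_z]. *)
Record rec_env := RecEnv { env_m : nat; env_z : nat -> nat; env_n : nat;
  env_t : BVname;
  env_IH : forall z' x x', names_real env_z x -> names_real z' x' -> x' < x ->
    jumps (sval env_t).2 env_n x' ->
    kleene env_m (rec_ctx env_m env_n z' env_t)
      (charfun (least_jump (sval env_t).2 env_n) z') }.

Definition env_ctx (r : rec_env) := rec_ctx (env_m r) (env_n r) (env_z r) (env_t r).

Lemma env_ctx_E2 : has_E2 env_ctx.
Proof. by split; [exists 6%N | exists 5%N]. Qed.

Lemma has_E2_reindex (E E' : Type) (g : E' -> E) (phi : E -> seq arg) :
  has_E2 phi -> has_E2 (fun y => phi (g y)).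
Proof. by move=> [[N HN] [i Hi]]; split; [exists N | exists i] => y. Qed.

(** One unfolding of the recursion given by [charfun_least_jump]. The set passed to [Om] is computed
    by calling [env_m] on names of smaller points. *)
Lemma ucomp_least_jump_step :
  ucomp env_ctx (fun r => charfun (least_jump (sval (env_t r)).2 (env_n r)) (env_z r)).
Proof.
pose Y r := below (sval (env_t r)).2 (env_n r) (env_z r).
pose hit r i := jump_at (sval (env_t r)).1 (env_n r) (Om_seq (Y r) i) &&
  name_lt (Om_seq (Y r) i) (env_z r).
have HE := env_ctx_E2.
have HG : has_fun env_ctx (fun r => (sval (env_t r)).1) by exists 3%N.
have Hn : ucomp env_ctx env_n by uvar.
have Hz : ucomp (push env_ctx) (fun y => env_z y.1 y.2).
  by apply: (ucomp_appvar (a := fun y => env_z y.1) (i := 2)) => //; uvar.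
apply: (@ucomp_ext _ _ (fun r =>
    if jump_at (sval (env_t r)).1 (env_n r) (env_z r)
    then (~~ `[< exists i, hit r i >] : nat) else 0%N)).
  move=> r; have [Gf bf] := svalP (env_t r).
  by rewrite (charfun_least_jump _ _ Gf bf); case: jump_at.
apply: (ucomp_if (g := fun r => (~~ `[< exists i, hit r i >] : nat))).
- by auto with ctx.
- exact: (udec_jump_at HE HG Hn Hz).
- exact: ucomp_const.
pose J := {r | jump_at (sval (env_t r)).1 (env_n r) (env_z r)}.
have HEJ : has_E2 (fun r : J => env_ctx (sval r)).
  exact: has_E2_reindex HE.
apply: udec_neg; apply: (udec_ex HEJ (b := fun r : J => hit (sval r))).
have HE1 := has_E2_push HEJ.
have HY : ucomp (push (push (fun r : J => env_ctx (sval r))))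
    (fun y => Om_seq (Y (sval y.1.1)) y.1.2 y.2).
  apply: (ucomp_Omega (i := 6) (Om := fun=> Om) (F := fun y => charfun (Y (sval y.1.1)))
    (a := fun y => y.1.2.+1) (b := fun y => y.2)) => //.
  - pose c (y : J * nat * nat * (nat -> nat)) := let r := sval y.1.1.1 in
      name_lt y.2 (env_z r) && jump_at (sval (env_t r)).1 (env_n r) y.2.
    pose v (y : J * nat * nat * (nat -> nat)) := let r := sval y.1.1.1 in
      charfun (least_jump (sval (env_t r)).2 (env_n r)) y.2.
    (* The guard [c] restricts recursive calls to jumps strictly below [env_z], where the induction
       hypothesis applies; elsewhere membership in [below] fails. *)
    apply: (@ucomp_ext _ _ (fun y => if c y then v y else 0%N)).
      move=> [[[[r Hr] i] j] z']; rewrite /c /v /=.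
      have [Gf _] := svalP (env_t r); have [x zx _] := jump_atP _ _ Gf Hr.
      case: ifP => [/andP[+ /(jump_atP _ _ Gf)[x' zx' jx']]|H].
        rewrite (name_ltE zx' zx) => lt; rewrite !(charfunE _ zx').
        congr nat_of_bool; apply/asboolP/asboolP => [mx|[]//].
        by split => //; exists x.
      apply/esym/eqP; rewrite eqb0; apply/asboolP => -[x' zx' [[jx' mx'] [x1 zx1 lt]]].
      move: H; rewrite (name_ltE zx' zx1) lt /= => /negbT/negP; apply.
      by apply/jump_atP; [exact: Gf | exists x'].
    have HE3 : has_E2 (pushf (push (push (fun r : J => env_ctx (sval r))))).
      by auto with ctx.
    have Hz' : ucomp (push (pushf (push (push (fun r : J => env_ctx (sval r))))))
        (fun y => y.1.2 y.2).
      by apply: (ucomp_appvar (a := fun y => y.1.2) (i := 1)) => //; uvar.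
    apply: (ucomp_if (b := c) (g := v)); first by auto with ctx.
    + apply: udec_and.
        apply: (udec_name_lt (al := fun y => y.2)
          (be := fun y => env_z (sval y.1.1.1))) => //.
        apply: (ucomp_appvar (a := fun y => env_z (sval y.1.1.1.1)) (i := 5)) => //.
        by uvar.
      apply: (udec_jump_at (n := fun y => env_n (sval y.1.1.1)) (al := fun y => y.2)
        (G := fun y => (sval (env_t (sval y.1.1.1))).1)) => //.
        by exists 6%N.
      by uvar.
    + exact: ucomp_const.
    (* From the context [z'], [j], [i], [m], [z], [n] and the base, the call keeps [m], [z'], [n]
       and the base. *)
    apply: (ucomp_univ (ps := [:: 3; 0; 5; 6; 7; 8]%N)
      (m := fun y => env_m (sval (sval y).1.1.1))) => //.
    + by exists 9%N.
    + by uvar.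
    move=> [[[[[r Hr] i] j] z'] Hy]; move: (Hy); rewrite /c /=.
    have [Gf _] := svalP (env_t r); have [x zx _] := jump_atP _ _ Gf Hr.
    move=> /andP[+ /(jump_atP _ _ Gf)[x' zx' jx']].
    rewrite (name_ltE zx' zx) => lt.
    exact: (env_IH zx zx' lt jx').
  - by apply: ucomp_succ; uvar.
  - by uvar.
  - move=> y; apply: (proj1 (Om_seqP _ _)); [exact: below_sub01 | exact: below_subset1].
apply: udec_and.
  apply: (udec_jump_at (n := fun y => env_n (sval y.1))
    (al := fun y => Om_seq (Y (sval y.1)) y.2)
    (G := fun y => (sval (env_t (sval y.1))).1)) => //.
    by exists 4%N.
  by uvar.
apply: (udec_name_lt (al := fun y => Om_seq (Y (sval y.1)) y.2)
  (be := fun y => env_z (sval y.1))) => //.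
apply: (ucomp_appvar (a := fun y => env_z (sval y.1.1)) (i := 3)) => //.
by uvar.
Qed.

(** The step is run with its own index. It is correct at all jumps, since otherwise the set of jumps
    where it fails would have a least element, and the step is correct there. *)
Lemma least_jump_program : exists d, forall n z t,
  kleene d (rec_ctx d n z t) (charfun (least_jump (sval t).2 n) z).
Proof.
have [d Hd] := ucomp_least_jump_step; exists d => n z t.
have [Gf bf] := svalP t.
pose P z := kleene d (rec_ctx d n z t) (charfun (least_jump (sval t).2 n) z).
have run z1 : (forall z' x x', names_real z1 x -> names_real z' x' -> x' < x ->
    jumps (sval t).2 n x' -> P z') -> P z1.
  by move=> IH; apply: (Hd (@RecEnv d z1 n t IH)).
have Pj z1 x : names_real z1 x -> jumps (sval t).2 n x -> P z1.
  move=> zx jx; apply: contrapT => nP.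
  pose S := [set x | jumps (sval t).2 n x /\ exists2 z, names_real z x & ~ P z].
  have SJ : S `<=` jumps (sval t).2 n by move=> y [].
  have S0 : S !=set0 by exists x; split => //; exists z1.
  have [x0 [_ [z0 zx0 nP0]] min0] := jumps_has_min bf SJ S0.
  apply: nP0; apply: run => z' x1 x' zx1 zx' lt jx'; apply: contrapT => nP'.
  have : S x' by split => //; exists z'.
  by move=> /min0; rewrite (names_real_inj zx0 zx1) leNgt lt.
(* Other arguments need only the smaller jumps, which are covered. *)
by apply: run => z' _ x' _ zx' _ jx'; exact: Pj zx' jx'.
Qed.
End OmegaProgram.

(** * Enumerating the jumps and computing the supremum *)

Section JumpEnumeration.
Variable R : realType.
Implicit Types (f : R -> R).

Definition has_jump f (n : nat) : bool := `[< jumps f n !=set0 >].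
Definition any_jump f : bool := `[< exists n, has_jump f n >].

(** The implications keep the search total even when no jump exists, so that [jump_index] is
    computable without a case distinction. *)
Lemma jump_index_ex f n :
  exists m, (has_jump f n ==> (m == n)) && (any_jump f ==> has_jump f m).
Proof.
case: (boolP (has_jump f n)) => [jn|_]; first by exists n; rewrite eqxx jn !implybT.
case: (boolP (any_jump f)) => [/asboolP[m jm]|_]; last by exists 0%N.
by exists m; rewrite jm.
Qed.

(* [n] itself if [jumps f n] is nonempty, else the first index where it is. *)
Definition jump_index f n : nat := ex_minn (jump_index_ex f n).

(* [-1] is the designated value when there is no jump at all. *)
Definition jump_enum f n : R :=
  if any_jump f then xget 0 (least_jump f (jump_index f n)) else -1.

Lemma least_jump_xget f n : bounded_variation 0 1 f -> has_jump f n ->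
  least_jump f n (xget 0 (least_jump f n)).
Proof.
move=> bf /asboolP jn; apply: xgetPex.
by have [x jx mx] := jumps_has_min bf (@subset_refl _ (jumps f n)) jn; exists x.
Qed.

Lemma jump_enumP f : bounded_variation 0 1 f ->
  range (jump_enum f) = discontinuities f \/
  (discontinuities f = set0 /\ forall n, jump_enum f n = -1).
Proof.
move=> bf; rewrite discontinuitiesE //; case aj : (any_jump f); last first.
  right; split; last by move=> n; rewrite /jump_enum aj.
  apply/seteqP; split => // x [k jk]; have [p jp _] := jump_set_isolated bf jk.
  by move/asboolP : aj; apply; exists (CodeSeq.code [:: p; k]); apply/asboolP; exists x.
left; apply/seteqP; split => [_ [n _ <-]|x [k jk]].
  rewrite /jump_enum aj /jump_index; case: ex_minnP => m /andP[_].
  rewrite aj => /(least_jump_xget bf)[[p [k [_ _ jk]]] _] _.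
  by exists k.
have [p jp xmin] := jump_set_isolated bf jk.
set n := CodeSeq.code _ in jp xmin.
have hn : has_jump f n by apply/asboolP; exists x.
exists n => //; rewrite /jump_enum aj.
have -> : jump_index f n = n.
  by rewrite /jump_index; case: ex_minnP => m; rewrite hn /= => /andP[/eqP].
apply: (@least_jump_subset1 _ f n); first exact: least_jump_xget.
by split.
Qed.

Lemma eq_jump_set f g k : {in `[0, 1], f =1 g} -> jump_set f k = jump_set g k.
Proof.
move=> fg; apply/seteqP; split => x [x01 H]; split => // m;
  have [c [c01 cx ck]] := H m; exists c; split => //.
  by rewrite -!fg.
by rewrite !fg.
Qed.
End JumpEnumeration.

(** * Programs relative to [Om] in contexts that end with [base] *)

Section Programs.
Variables (R : realType) (Om : pfun (tSet ⇒ tSeq)).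
Hypothesis HOm : is_Omega R Om.

Section BaseContext.
Variables (E : Type) (phi : E -> seq arg) (k : nat) (g : E -> BVname R).
Hypothesis Hk : forall x, iter k behead (phi x) = base Om (g x).
Let G x := (sval (g x)).1.
Let f x := (sval (g x)).2.

Lemma base_nth x i : (i < 3)%N ->
  nth (num 0) (phi x) (k + i) = nth (num 0) (base Om (g x)) i.
Proof. by move=> i3; rewrite -nth_drop drop_behead Hk. Qed.

Lemma base_size x : size (phi x) = (k + 3)%N.
Proof.
have := congr1 size (Hk x); rewrite -drop_behead size_drop /= => E3.
by rewrite -(subnKC (n := size (phi x)) (m := k)) ?E3 // ltnW // -subn_gt0 E3.
Qed.

Lemma base_onth x i : (i < 3)%N ->
  onth (phi x) (k + i) = Some (nth (num 0) (base Om (g x)) i).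
Proof.
move=> i3; rewrite -base_nth // onthE.
by rewrite (nth_map (num 0)) // base_size ltn_add2l.
Qed.

Lemma base_sized : sized phi.
Proof. by exists (k + 3)%N => x; rewrite base_size. Qed.

Lemma base_E2 : has_E2 phi.
Proof. by split; [exact: base_sized | exists (k + 2)%N => x; rewrite base_onth]. Qed.

Lemma base_fun : has_fun phi G.
Proof. by exists (k + 0)%N => x; rewrite base_onth. Qed.

Lemma base_push : forall y, iter k.+1 behead (push phi y) = base Om (g y.1).
Proof. by move=> y; rewrite iterSr Hk. Qed.

(** The index from [least_jump_program] enters as a constant twice: as the program that is run and
    as its first argument. *)
Lemma ucomp_least_jump_seq (n i j : E -> nat) :
  ucomp phi n -> ucomp phi i -> ucomp phi j ->
  ucomp phi (fun x => Om_seq Om (least_jump (f x) (n x)) (i x) (j x)).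
Proof.
move=> Hn Hi Hj; have [d Hd] := least_jump_program HOm; have sz := base_sized.
apply: (ucomp_Omega (i := (k + 1)%N) (Om := fun=> Om)
  (F := fun x => charfun (least_jump (f x) (n x))) (a := fun x => (i x).+1) (b := j)).
- by move=> x; rewrite base_onth.
- apply: (ucomp_let (a := fun y => n y.1)).
    by apply: (ucomp_weak (k := 1) _ _ _ Hn).
  apply: (ucomp_let (ucomp_const _ d)).
  apply: (ucomp_univ (ps := [:: 0; 2; 1; k.+3; k.+4; k.+4.+1]%N) (m := fun=> d)).
  + by auto with ctx.
  + by rewrite /= !inE; lia.
  + by move=> y; rewrite /= base_size; lia.
  + exact: ucomp_const.
  move=> [x z] /=; have := Hd (n x) z (g x).
  rewrite -[X in nth _ _ X]addn0 base_nth // -[X in nth _ _ X.+1]addn0 -addnS base_nth //.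
  by rewrite -[X in nth _ _ X.+2]addn0 -!addnS base_nth.
- exact: ucomp_succ.
- exact: Hj.
move=> x; apply: (proj1 (Om_seqP HOm _ _)); [exact: least_jump_sub01|exact: least_jump_subset1].
Qed.

End BaseContext.

Section JumpHit.
Variables (E : Type) (phi : E -> seq arg) (k : nat) (g : E -> BVname R).
Hypothesis Hk : forall x, iter k behead (phi x) = base Om (g x).
Let G x := (sval (g x)).1.
Let f x := (sval (g x)).2.
Let w x n i := Om_seq Om (least_jump (f x) n) i.

Lemma ucomp_hit (n i : E -> nat) : ucomp phi n -> ucomp phi i ->
  ucomp (push phi) (fun y => w y.1 (n y.1) (i y.1) y.2).
Proof.
move=> Hn Hi; have sz := base_sized Hk.
apply: (ucomp_least_jump_seq (base_push Hk)).
- by apply: (ucomp_weak (k := 1) sz _ _ Hn).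
- by apply: (ucomp_weak (k := 1) sz _ _ Hi).
- by uvar.
Qed.

Lemma udec_jump_hit (n i : E -> nat) : ucomp phi n -> ucomp phi i ->
  udec phi (fun x => jump_at (G x) (n x) (w x (n x) (i x))).
Proof.
move=> Hn Hi; have HE := base_E2 Hk; have HG := base_fun Hk.
exact: (udec_jump_at HE HG Hn (ucomp_hit Hn Hi)).
Qed.
End JumpHit.

Section HasJump.
Variables (E : Type) (phi : E -> seq arg) (k : nat) (g : E -> BVname R).
Hypothesis Hk : forall x, iter k behead (phi x) = base Om (g x).
Let G x := (sval (g x)).1.
Let f x := (sval (g x)).2.
Let w x n i := Om_seq Om (least_jump (f x) n) i.

Lemma hit_least x n y : least_jump (f x) n y -> exists i, names_real (w x n i) y.
Proof.
by move=> my; apply: (proj2 (Om_seqP HOm (@least_jump_sub01 _ (f x) n)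
  (@least_jump_subset1 _ (f x) n))).
Qed.

(** A quantifier over reals becomes one over rows: the least jump occurs among the rows, and any row
    passing the test names a jump. *)
Lemma has_jumpE x n : has_jump (f x) n = `[< exists i, jump_at (G x) n (w x n i) >].
Proof.
have [Gf bf] := svalP (g x); apply/idP/asboolP => [jn|[i /(jump_atP _ _ Gf)[y _ jy]]].
  have [jm _] := least_jump_xget bf jn.
  have [i Hi] := hit_least (least_jump_xget bf jn).
  by exists i; apply/(jump_atP _ _ Gf); eexists; [exact: Hi | exact: jm].
by apply/asboolP; exists y.
Qed.

(** Being below the least jump means being below every row that names a jump. No particular row is
    selected, so the answer does not depend on [Om]. *)
Lemma lt_least_jumpE x n c : has_jump (f x) n ->
  (qval R c < xget 0 (least_jump (f x) n)) =
  `[< forall i, jump_at (G x) n (w x n i) ==> lcut c (w x n i) >].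
Proof.
have [Gf bf] := svalP (g x); move=> jn; have mj := least_jump_xget bf jn.
set m := xget _ _ in mj *.
apply/idP/asboolP => [cm i|H].
  apply/implyP => /(jump_atP _ _ Gf)[y iy jy]; rewrite (lcutE _ iy).
  exact: lt_le_trans cm (proj2 mj _ jy).
have [i im] := hit_least mj; have := H i; rewrite (lcutE _ im) => /implyP; apply.
by apply/(jump_atP _ _ Gf); exists m => //; exact: (proj1 mj).
Qed.

Lemma udec_has_jump (n : E -> nat) : ucomp phi n ->
  udec phi (fun x => has_jump (f x) (n x)).
Proof.
move=> Hn; have sz := base_sized Hk; apply: (@ucomp_ext _ _ _ _
  (fun x => congr1 nat_of_bool (esym (has_jumpE x (n x))))).
apply: (udec_ex (base_E2 Hk)).
apply: (udec_jump_hit (base_push Hk) (n := fun y => n y.1)); last by uvar.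
by apply: (ucomp_weak (k := 1) sz _ _ Hn).
Qed.
End HasJump.

Section JumpIndex.
Variables (E : Type) (phi : E -> seq arg) (k : nat) (g : E -> BVname R).
Hypothesis Hk : forall x, iter k behead (phi x) = base Om (g x).
Let f x := (sval (g x)).2.

Lemma udec_any_jump : udec phi (fun x => any_jump (f x)).
Proof.
apply: (udec_ex (base_E2 Hk)); apply: (udec_has_jump (base_push Hk)); uvar.
Qed.

Lemma ucomp_jump_index (n : E -> nat) : ucomp phi n ->
  ucomp phi (fun x => jump_index (f x) (n x)).
Proof.
move=> Hn; have sz := base_sized Hk; apply: ucomp_mu => //.
have Hn' : ucomp (push phi) (fun y => n y.1) by apply: (ucomp_weak (k := 1) sz _ _ Hn).
apply: udec_and; apply: udec_imp.
- exact: (udec_has_jump (base_push Hk)).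
- by apply: udec_eq => //; uvar.
- exact: (ucomp_weak (k := 1) sz _ _ udec_any_jump).
- by apply: (udec_has_jump (base_push Hk)); uvar.
Qed.
End JumpIndex.

Section LowerCuts.
Variables (E : Type) (phi : E -> seq arg) (k : nat) (g : E -> BVname R).
Hypothesis Hk : forall x, iter k behead (phi x) = base Om (g x).
Let G x := (sval (g x)).1.
Let f x := (sval (g x)).2.
Let w x n i := Om_seq Om (least_jump (f x) n) i.

Lemma udec_lt_jump_enum (n c : E -> nat) : ucomp phi n -> ucomp phi c ->
  udec phi (fun x => qval R (c x) < jump_enum (f x) (n x)).
Proof.
move=> Hn Hc; have sz := base_sized Hk; have HE := base_E2 Hk.
pose m x := jump_index (f x) (n x).
apply: (@ucomp_ext _ _ (fun x => (any_jump (f x) && `[< forall i,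
    jump_at (G x) (m x) (w x (m x) i) ==> lcut (c x) (w x (m x) i) >]) ||
  (~~ any_jump (f x) && qlt (c x) codeN1))).
  move=> x; congr nat_of_bool; rewrite /jump_enum; case: ifP => aj /=; last first.
    by rewrite (qltE R) qvalN1.
  rewrite orbF lt_least_jumpE // /jump_index; case: ex_minnP => ? /andP[_].
  by rewrite aj.
have Ha := udec_any_jump Hk.
apply: udec_or; apply: udec_and => //; last first.
- by apply: udec_qlt => //; exact: ucomp_const.
- exact: udec_neg.
apply: (ucomp_let (ucomp_jump_index Hk Hn)).
have Hk' : forall x, iter k.+1 behead (plet m phi x) = base Om (g x).
  by move=> x; rewrite iterSr Hk.
apply: udec_all; first by auto with ctx.
have Hm : ucomp (push (plet m phi)) (fun y => m y.1) by uvar.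
have Hi : ucomp (push (plet m phi)) (fun y => y.2) by uvar.
apply: udec_imp.
  exact: (udec_jump_hit (base_push Hk') Hm Hi).
have Hc' : ucomp (push (plet m phi)) (fun y => c y.1).
  by apply: (ucomp_weak (k := 2) sz _ _ Hc).
apply: (udec_lcut _ Hc' (al := fun y => w y.1 (m y.1) y.2)); first by auto with ctx.
exact: (ucomp_hit (base_push Hk') Hm Hi).
Qed.

(** By [lt_sup_witness] it suffices to compare [c] with the values at rationals and at those rows of
    [Om] that name jumps. *)
Lemma udec_lt_sup (c : E -> nat) : ucomp phi c ->
  udec phi (fun x => qval R (c x) < sup (f x @` `[0, 1])).
Proof.
move=> Hc; have sz := base_sized Hk; have HE := base_E2 Hk; have HG := base_fun Hk.
apply: (@ucomp_ext _ _ (fun x =>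
  `[< exists d, in01 d && lcut (c x) (G x (fun=> d)) >] ||
  `[< exists n, `[< exists i, jump_at (G x) n (w x n i) &&
       lcut (c x) (G x (w x n i)) >] >])).
  move=> x; congr nat_of_bool; have [Gf bf] := svalP (g x).
  have ltf y : y \in `[0, 1] -> qval R (c x) < f x y -> qval R (c x) < sup (f x @` `[0, 1]).
    move=> y01 cy; apply: lt_le_trans cy _; apply: ub_le_sup; last by exists y.
    exact: (proj2 (BV_has_sup bf)).
  apply/orP/idP => [[/asboolP[d]|/asboolP[n /asboolP[i]]]|].
  - rewrite (in01E R) => /andP[d01]; rewrite (lcutE _ (Gf _ _ d01 (names_qval _ d))).
    exact: ltf.
  - move=> /andP[/(jump_atP _ _ Gf)[y iy [p [l [_ _ [y01 _]]]]]].
    rewrite (lcutE _ (Gf _ _ y01 iy)); exact: ltf.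
  move=> /(lt_sup_witness bf)[[d d01 cd]|[n [y [jy my cy]]]]; [left|right].
    apply/asboolP; exists d.
    by rewrite (in01E R) d01 (lcutE _ (Gf _ _ d01 (names_qval _ d))).
  have [i iy] : exists i, names_real (w x n i) y by apply: hit_least.
  have y01 : y \in `[0, 1] by case: jy => p [l [_ _ []]].
  apply/asboolP; exists n; apply/asboolP; exists i.
  rewrite (lcutE _ (Gf _ _ y01 iy)) cy andbT.
  by apply/(jump_atP _ _ Gf); exists y.
apply: udec_or.
  apply: udec_ex => //; have HE1 := has_E2_push HE.
  apply: udec_and; first by apply: udec_in01 => //; uvar.
  have [j Hj] : has_fun (push (push phi)) (fun y => G y.1.1).
    exact: (has_fun_weak (k := 2) _ HG).
  have Hc' : ucomp (push phi) (fun y => c y.1) by apply: (ucomp_weak (k := 1) sz _ _ Hc).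
  apply: (udec_lcut HE1 Hc' (al := fun y => G y.1 (fun=> y.2))).
  by apply: (ucomp_fun (b := fun y => fun=> y.1.2) Hj); uvar.
have HE2 := has_E2_push (has_E2_push HE).
do 2! [apply: udec_ex; first by auto with ctx].
have Hk2 := base_push (base_push Hk).
have Hn : ucomp (push (push phi)) (fun y => y.1.2) by uvar.
have Hi : ucomp (push (push phi)) (fun y => y.2) by uvar.
apply: udec_and; first exact: (udec_jump_hit Hk2 Hn Hi).
have Hc' : ucomp (push (push phi)) (fun y => c y.1.1).
  by apply: (ucomp_weak (k := 2) sz _ _ Hc).
apply: (udec_lcut HE2 Hc' (al := fun y => G y.1.1 (w y.1.1 y.1.2 y.2))).
have [j Hj] := base_fun (base_push Hk2).
apply: (ucomp_fun (G := fun y => G y.1.1.1) (b := fun y => w y.1.1.1 y.1.1.2 y.1.2) Hj).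
  by apply: (ucomp_least_jump_seq (base_push (base_push Hk2)) (n := fun y => y.1.1.1.2)
    (i := fun y => y.1.1.2) (j := fun y => y.2)); uvar.
by uvar.
Qed.

End LowerCuts.

Section Outputs.
Variables (E : Type) (phi : E -> seq arg) (k : nat) (g : E -> BVname R).
Hypothesis Hk : forall x, iter k behead (phi x) = base Om (g x).
Let f x := (sval (g x)).2.

Lemma ucomp_jump_enum (n j : E -> nat) : ucomp phi n -> ucomp phi j ->
  ucomp phi (fun x => least_name (fun c => qval R c < jump_enum (f x) (n x)) (j x)).
Proof.
move=> Hn Hj; have sz := base_sized Hk.
apply: (ucomp_least_name (L := fun x c => qval R c < jump_enum (f x) (n x))
  (base_E2 Hk) _ Hj); last by move=> x; exact: lower_approx_ex.
apply: (udec_lt_jump_enum (base_push Hk) (n := fun y => n y.1)); last by uvar.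
by apply: (ucomp_weak (k := 1) sz _ _ Hn).
Qed.

Lemma ucomp_sup (j : E -> nat) : ucomp phi j ->
  ucomp phi (fun x => least_name (fun c => qval R c < sup (f x @` `[0, 1])) (j x)).
Proof.
move=> Hj; apply: (ucomp_least_name
  (L := fun x c => qval R c < sup (f x @` `[0, 1])) (base_E2 Hk) _ Hj);
  last by move=> x; exact: lower_approx_ex.
by apply: (udec_lt_sup (base_push Hk)); uvar.
Qed.
End Outputs.

End Programs.

(** * Computing Omega from the tasks *)

Section Spike.
Variable R : realType.

Definition spike (a v : R) : R -> R := fun x => if x == a then v else 0.

Lemma spikeE a v : spike a v = (fun x => v * \1_[set a] x).
Proof.
apply/funext => x; rewrite /spike indicE.
case: eqP => [->|xa]; first by rewrite mem_set ?mulr1.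
by rewrite memNset ?mulr0.
Qed.

Lemma measurable_spike a v : measurable_fun (`[0, 1] : set R) (spike a v).
Proof.
rewrite spikeE; apply: measurable_funM; first exact: measurable_cst.
exact: measurable_indic.
Qed.

Lemma integrable_spike a v : L1_01 (spike a v).
Proof.
have [] := @negligible_integrable _ _ _ (@lebesgue_measure R) `[0, 1] [set a]
  (EFin \o spike a v) _ _ _ _ => //.
- by apply/measurable_EFinP; exact: measurable_spike.
- exact: lebesgue_measure_set1.
move=> _; apply.
apply: (@eq_integrable _ _ _ _ _ _ (cst 0%E)) => //; last exact: integrable0.
  exact: measurableD.
by move=> x /set_mem[_ /= xa]; rewrite /spike; case: eqP.
Qed.

Lemma Rintegral_spike a v :
  \int[@lebesgue_measure R]_(t in `[0, 1]) (spike a v t) = 0.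
Proof.
rewrite /Rintegral (@negligible_integral _ _ _ (@lebesgue_measure R) `[0, 1] [set a]) //.
- rewrite integral0_eq // => x [_ /= xa]; rewrite /spike.
  by case: eqP.
- exact: integrable_spike.
- exact: lebesgue_measure_set1.
Qed.

(** A spike is the difference of two step functions at [a], nondecreasing as [v] is nonnegative. *)
Lemma BV_spike a v : 0 <= v -> bounded_variation 0 1 (spike a v).
Proof.
move=> v0; pose g x := if a <= x then v else 0; pose h x := if a < x then v else 0.
have -> : spike a v = g \+ (\- h).
  apply/funext => x; rewrite /spike /g /h /=.
  by case: ltgtP => _; rewrite ?subrr ?subr0.
apply: bounded_variationD => //.
  apply: nondecreasing_bounded_variation => x y _ _ xy; rewrite /g.
  case: ifP => ax; first by rewrite (le_trans ax xy).
  by case: ifP.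
apply: bounded_variationN.
apply: nondecreasing_bounded_variation => x y _ _ xy; rewrite /h.
case: ifP => ax; first by rewrite (lt_le_trans ax xy).
by case: ifP.
Qed.

Lemma W11_spike a v : 0 <= v -> W11 (spike a v).
Proof.
move=> v0; split; [exact: BV_spike | exact: integrable_spike |].
exists (cst 0) => [|D _ _ _]; first exact: integrable0.
rewrite [LHS](_ : _ = 0); last first.
  (* The product with a test function is again a spike at [a], so its integral vanishes and 0 is a
     weak derivative. *)
  rewrite -[RHS](Rintegral_spike a (v * D 1%N a)); apply: eq_Rintegral => x _.
  by rewrite /spike; case: eqP => [->//|_]; rewrite mul0r.
apply/esym/eqP; rewrite oppr_eq0; apply/eqP.
rewrite -[RHS](Rintegral_spike 0 0); apply: eq_Rintegral => x _.
by rewrite /spike mul0r if_same.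
Qed.

Lemma spike_image a v : a \in `[0, 1] -> 0 <= v -> sup (spike a v @` `[0, 1]) = v.
Proof.
move=> a01 v0.
have Hs : has_ubound (spike a v @` `[0, 1]).
  by exists v => _ [x _ <-]; rewrite /spike; case: ifP.
apply/eqP; rewrite eq_le; apply/andP; split.
  apply: ge_sup; first by exists (spike a v a), a.
  by move=> _ [x _ <-]; rewrite /spike; case: ifP.
by apply: (ub_le_sup Hs); exists a => //; rewrite /spike eqxx.
Qed.

Lemma discontinuities_spike a : a \in `[0, 1] -> discontinuities (spike a 1) = [set a].
Proof.
move=> a01; rewrite discontinuitiesE; last exact: BV_spike.
have n01 m : 0 < 2 ^- m :> R by rewrite invr_gt0 exprn_gt0.
apply/seteqP; split => x.
  move=> [k [x01 H]]; apply: contrapT => /eqP xa.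
  have [m Hm] : exists m, 2 ^- m < `|a - x|.
    by apply: pow2V_lt; rewrite normr_gt0 subr_eq0 eq_sym.
  have [c [_ cx]] := H m; rewrite /spike (negbTE xa).
  case: eqP => [ca|_]; last by rewrite subrr normr0 ltNge ltW.
  by move: cx; rewrite ca ltNge ltW.
(* The jump has height 1, which exceeds [2 ^- 1]; it remains to find rationals near [a] other than
   [a]. *)
move=> ->; exists 1%N; split => // m.
have /andP[a0 a1] : 0 <= a <= 1 by move: a01; rewrite in_itv.
have [c [c01 ca cx]] : exists c, [/\ qval R c \in `[0, 1], qval R c != a &
    `|qval R c - a| < 2 ^- m].
  have [alt|age] := ltP a 1.
    have [|c ac] := @qval_dense R a (Num.min 1 (a + 2 ^- m)).
      by rewrite lt_min alt ltrDl n01.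
    rewrite lt_min => /andP[? ?]; exists c.
    split; rewrite ?in_itv ?ltr_distl ?gt_eqF //=; lra.
  have [|c] := @qval_dense R (Num.max 0 (a - 2 ^- m)) a.
    by rewrite gt_max ltrBlDr ltrDl n01 andbT; lra.
  rewrite gt_max => /andP[? ?] ?; exists c.
  by split; rewrite ?in_itv ?ltr_distl ?lt_eqF //=; lra.
exists c; split => //; rewrite /spike eqxx (negbTE ca) sub0r normrN normr1 expr1.
lra.
Qed.

Lemma subset1_cases (X : set R) : X `<=` `[0, 1] -> is_subset1 X ->
  exists2 a, a \in `[0, 1] & X = [set a] \/ X = set0.
Proof.
move=> X01 X1; have [[a Xa]|nX] := pselect (X !=set0).
  exists a; first exact: X01.
  by left; apply/seteqP; split => [x Xx|x ->]; [exact: X1|].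
exists 0; first by rewrite in_itv /= lexx ler01.
by right; apply/seteqP; split => // x Xx; apply: nX; exists x.
Qed.
End Spike.

(** * Oracle calls, and Omega obtained from a single real *)

Section Oracles.
Variables (E : Type) (phi : E -> seq arg).

Lemma ucomp_set i (F : E -> tot tSet) (b : E -> nat -> nat) :
  (forall x, onth (phi x) i = Some (targ (F x))) ->
  ucomp (push phi) (fun y => b y.1 y.2) -> ucomp phi (fun x => F x (b x)).
Proof.
move=> HF [e He]; exists (CodeSeq.code [:: 8, i & [:: e]]) => x.
apply: (@S8_appl i [:: e] (phi x) (targ (F x)) (b x, tt)) => //.
by move=> [|[|j]] G //= [<-] /= [n []] /=; apply: (He (x, n)).
Qed.

Lemma ucomp_seq_oracle i (Phi : E -> pfun (tFun ⇒ tSeq))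
    (H : E -> tot tFun) (a b f : E -> nat) :
  (forall x, onth (phi x) i = Some (parg (Phi x))) ->
  ucomp (pushf (push phi)) (fun y => H y.1.1 y.2 y.1.2) ->
  ucomp phi a -> ucomp phi b ->
  (forall x, Phi x (H x, (a x, (b x, tt))) = Some (f x)) -> ucomp phi f.
Proof.
move=> HO [e He] [ea Ha] [eb Hb] Hf.
exists (CodeSeq.code [:: 8, i & [:: e; ea; eb]]) => x.
apply: (@S8_appl i [:: e; ea; eb] (phi x) (parg (Phi x))
         (H x, (a x, (b x, tt)))) => //; last exact: Hf.
move=> [|[|[|[|j]]]] G //= [<-] /=.
- by move=> [al [n []]]; apply: (He (x, n, al)).
- by move=> xi; apply: Ha.
- by move=> xi; apply: Hb.
Qed.

Lemma ucomp_real_oracle i (Phi : E -> pfun (tFun ⇒ tReal))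
    (H : E -> tot tFun) (b f : E -> nat) :
  (forall x, onth (phi x) i = Some (parg (Phi x))) ->
  ucomp (pushf (push phi)) (fun y => H y.1.1 y.2 y.1.2) -> ucomp phi b ->
  (forall x, Phi x (H x, (b x, tt)) = Some (f x)) -> ucomp phi f.
Proof.
move=> HO [e He] [eb Hb] Hf.
exists (CodeSeq.code [:: 8, i & [:: e; eb]]) => x.
apply: (@S8_appl i [:: e; eb] (phi x) (parg (Phi x)) (H x, (b x, tt))) => //;
  last exact: Hf.
move=> [|[|[|j]]] G //= [<-] /=.
- by move=> [al [n []]]; apply: (He (x, n, al)).
- by move=> xi; apply: Hb.
Qed.
End Oracles.

Section OmegaFromOracle.
Variables (R : realType) (t : ty) (Phi : pfun t).
Variable query : tot tSet -> nat -> option nat.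

Definition Omega_input (F : tot tSet) : Prop :=
  exists X : set R, @task_name (Omega_task R) F X.

(** The output always has length 1, with digits given by [query]. For empty [X] the listed real is
    arbitrary, since the output need only include [X]. *)
Definition Omega_of : pfun (tSet ⇒ tSeq) := fun xi : args (tSet ⇒ tSeq) =>
  if pselect (Omega_input xi.1) is left _
  then (if xi.2.1 is 0%N then Some 1%N else query xi.1 xi.2.2.1) else None.

Hypothesis queryP : forall F X, @task_name (Omega_task R) F X ->
  exists s x, [/\ names_real s x, (forall y, X y -> y = x) &
    forall j, query F j = Some (s j)].

Lemma is_Omega_of : is_Omega R Omega_of.
Proof.
split=> [F X nX|F xi nX]; last first.
  by rewrite /Omega_of; case: pselect => // -[X nX']; case: nX; exists X.
have [s [x [sx Xx Hs]]] := queryP nX.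
exists (fun i j => if i is 0%N then 1%N else s j).
  exists [:: x]; first by split => // -[].
  by move=> y /Xx ->; rewrite mem_seq1.
move=> [[|i] [j []]]; rewrite /Omega_of /=; case: pselect => //.
  by case; exists X.
by case; exists X.
Qed.

Lemma computable_Omega_of :
  ucomp (fun y : {F | Omega_input F} * nat * nat =>
    [:: targ (sval y.1.1); num y.1.2; num y.2; parg Phi; targ E2])
    (fun y => odflt 0%N (query (sval y.1.1) y.2)) ->
  computable Omega_of [:: parg Phi; targ E2].
Proof.
move=> Hq; set phi := (X in ucomp X _) in Hq.
have sz : sized phi by exists 5%N.
have [e He] : ucomp phi (fun y => if (0 < y.1.2)%N
    then odflt 0%N (query (sval y.1.1) y.2) else 1%N).
  apply: ucomp_if => //.
  - by apply: udec_leq; [exact: ucomp_const | uvar].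
  - exact: ucomp_const.
  - exact: (ucomp_reindex _ Hq).
exists e => -[F [i [j []]]] a; rewrite /Omega_of /=.
case: pselect => // HF Ha; have /= := He (exist _ F HF, i, j).
by case: i Ha => [|i] /= => [[<-]|->].
Qed.
End OmegaFromOracle.

Section OmegaFromTasks.
Variable R : realType.

Definition indicator_fun (F : tot tSet) : tot tFun :=
  fun al _ => if F al == 0%N then code0 else code1.

Definition masked_id_fun (F : tot tSet) : tot tFun :=
  fun al n => if F al == 0%N then code0 else al n.

Lemma names_indicator F (X : set R) (f : R -> R) : names_set F X ->
  {in `[0, 1], f =1 fun x => if `[< X x >] then 1 else 0} ->
  names_fun (indicator_fun F) f.
Proof.
move=> FX Hf al x x01 alx; rewrite Hf // /indicator_fun (FX _ _ x01 alx).
by case: asboolP => _ /=; rewrite -?(qval1 R) -?(qval0 R); exact: names_qval.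
Qed.

Lemma names_masked_id F (X : set R) (f : R -> R) : names_set F X ->
  {in `[0, 1], f =1 fun x => if `[< X x >] then x else 0} ->
  names_fun (masked_id_fun F) f.
Proof.
move=> FX Hf al x x01 alx; rewrite Hf // /masked_id_fun (FX _ _ x01 alx).
by case: asboolP => _ //=; rewrite -(qval0 R); exact: names_qval.
Qed.

(** The first entry of the enumeration is queried: it is the element of [X] if there is one. For
    empty [X] the indicator is the zero function, treated as [spike a 0]. *)
Lemma Omega_from_discontinuities Phi :
  @performs (W11_discontinuities_task R) Phi -> Omega_computable_in R Phi.
Proof.
move=> perf; pose query F j := Phi (indicator_fun F, (0%N, (j, tt))).
have queryP F X : @task_name (Omega_task R) F X ->
    exists s x, [/\ names_real s x, (forall y, X y -> y = x) &
      forall j, query F j = Some (s j)].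
  move=> [X01 X1 FX]; have [a a01 [XE|XE]] := subset1_cases X01 X1.
    have nf : names_fun (indicator_fun F) (spike a 1).
      apply: (names_indicator FX) => x _; rewrite /spike XE.
      by congr (if _ then _ else _); apply/eqP/asboolP.
    have [s ss Hs] := perf _ _ (conj (W11_spike a ler01) nf).
    have [[x [sx rx]]|[]] := ss; last first.
      rewrite discontinuities_spike // => /seteqP[/(_ a erefl)] //.
    exists (s 0%N), (x 0%N); split => // [y|j]; last by rewrite /query Hs.
    rewrite XE => ->; have : range x (x 0%N) by exists 0%N.
    by rewrite rx discontinuities_spike.
  have nf : names_fun (indicator_fun F) (spike a 0).
    apply: (names_indicator FX) => x _; rewrite /spike XE if_same.
    by case: asboolP.
  have [s ss Hs] := perf _ _ (conj (W11_spike a (lexx _)) nf).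
  have [[x [sx rx]]|[_ sx]] := ss.
    exists (s 0%N), (x 0%N); split => // [y|j]; last by rewrite /query Hs.
    by rewrite XE.
  exists (s 0%N), (-1); split => // [y|j]; last by rewrite /query Hs.
  by rewrite XE.
exists (Omega_of R query); first exact: is_Omega_of.
apply: computable_Omega_of.
apply: (ucomp_seq_oracle (i := 3) (Phi := fun=> Phi)
  (H := fun y => indicator_fun (sval y.1.1)) (a := fun=> 0%N) (b := fun y => y.2)) => //.
- set phi := pushf _; have sz : sized phi by exists 7%N.
  apply: (ucomp_if (b := fun y => sval y.1.1.1.1 y.2 == 0%N) sz).
  + apply: udec_eq0; apply: (ucomp_set (i := 2) (F := fun y => sval y.1.1.1.1)
      (b := fun y => y.2)) => //.
    by apply: (ucomp_appvar (a := fun y => y.1.2) (i := 1)) => //; uvar.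
  + exact: ucomp_const.
  + exact: ucomp_const.
- exact: ucomp_const.
- by uvar.
move=> [[[F [X nX]] i] j]; have [s [x [_ _ Hs]]] := queryP F X nX.
by have := Hs j; rewrite /query => ->.
Qed.

(** The supremum is the element of [X], or 0 if [X] is empty. The cases of an empty [X] and of [X]
    containing just 0 give the same function, but the answer 0 is right for both. *)
Lemma Omega_from_sup Phi :
  @performs (W11_sup_task R) Phi -> Omega_computable_in R Phi.
Proof.
move=> perf; pose query F j := Phi (masked_id_fun F, (j, tt)).
have queryP F X : @task_name (Omega_task R) F X ->
    exists s x, [/\ names_real s x, (forall y, X y -> y = x) &
      forall j, query F j = Some (s j)].
  move=> [X01 X1 FX]; have [a a01 XE] := subset1_cases X01 X1.
  have [v v0 [Hv HXv]] : exists2 v, 0 <= v & (forall y, X y -> y = v) /\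
      names_fun (masked_id_fun F) (spike a v).
    have a0 : 0 <= a by move: a01; rewrite in_itv => /andP[].
    case: XE => XE; [exists a | exists 0] => //; split.
    - by rewrite XE.
    - apply: (names_masked_id FX) => x _; rewrite /spike XE.
      by case: eqP; case: asboolP => // ->.
    - by rewrite XE.
    - apply: (names_masked_id FX) => x _; rewrite /spike XE if_same.
      by case: asboolP.
  have [s ss Hs] := perf _ _ (conj (W11_spike a v0) HXv).
  exists s, v; split => // [|j]; last by rewrite /query Hs.
  by move: ss; rewrite /= spike_image.
exists (Omega_of R query); first exact: is_Omega_of.
apply: computable_Omega_of.
apply: (ucomp_real_oracle (i := 3) (Phi := fun=> Phi)
  (H := fun y => masked_id_fun (sval y.1.1)) (b := fun y => y.2)) => //.
- set phi := pushf _; have sz : sized phi by exists 7%N.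
  apply: (ucomp_if (b := fun y => sval y.1.1.1.1 y.2 == 0%N)
    (f := fun y => y.2 y.1.2) (g := fun=> code0) sz).
  + apply: udec_eq0; apply: (ucomp_set (i := 2) (F := fun y => sval y.1.1.1.1)
      (b := fun y => y.2)) => //.
    by apply: (ucomp_appvar (a := fun y => y.1.2) (i := 1)) => //; uvar.
  + by apply: (ucomp_appvar (a := fun y => y.2) (i := 0)) => //; uvar.
  + exact: ucomp_const.
- by uvar.
move=> [[[F [X nX]] i] j]; have [s [x [_ _ Hs]]] := queryP F X nX.
by have := Hs j; rewrite /query => ->.
Qed.
End OmegaFromTasks.

(** * Performing the tasks with Omega *)

Section TasksFromOmega.
Variable R : realType.

Definition W11_name (F : tot tFun) : Prop := exists f : R -> R, W11 f /\ names_fun F f.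

(** The function is picked by choice from those named by the input; all of them agree on the unit
    interval by [names_fun_inj]. The functional is undefined on other inputs. *)
Definition W11_functional (t : ty) (out : (R -> R) -> tot t) : pfun (tFun ⇒ t) :=
  fun xi : args (tFun ⇒ t) => if pselect (W11_name xi.1) is left ex
    then Some (appl (out (sval (cid ex))) xi.2) else None.

Lemma W11_functionalP (t : ty) (out : (R -> R) -> tot t) F f :
  W11 f -> names_fun F f -> exists g, [/\ W11 g, {in `[0, 1], f =1 g} &
    forall xi, W11_functional out (F, xi) = Some (appl (out g) xi)].
Proof.
move=> Wf Ff; rewrite /W11_functional /=; case: pselect => [ex|]; last first.
  by case; exists f.
case: (cid ex) => g /= [Wg Fg]; exists g; split => //.
exact: names_fun_inj Ff Fg.
Qed.

Definition disc_out (f : R -> R) : tot tSeq :=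
  fun n j => least_name (fun c => qval R c < jump_enum f n) j.

Definition sup_out (f : R -> R) : tot tReal :=
  fun j => least_name (fun c => qval R c < sup (f @` `[0, 1])) j.

Lemma performs_disc :
  @performs (W11_discontinuities_task R) (W11_functional disc_out).
Proof.
move=> F f [Wf Ff]; have [g [Wg fg Hg]] := W11_functionalP disc_out Wf Ff.
exists (disc_out g) => //=.
have [[bf _ _] [bg _ _]] := (Wf, Wg).
have -> : discontinuities f = discontinuities g.
  rewrite !discontinuitiesE //; apply/seteqP; split => x [k jk]; exists k;
    by rewrite ?(eq_jump_set k fg) // -(eq_jump_set k fg).
have [rg|[d0 eg]] := jump_enumP bg; [left|right].
  by exists (jump_enum g); split => // n; exact: names_least_name.
by split => // n; rewrite -(eg n); exact: names_least_name.
Qed.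

Lemma performs_sup : @performs (W11_sup_task R) (W11_functional sup_out).
Proof.
move=> F f [Wf Ff]; have [g [Wg fg Hg]] := W11_functionalP sup_out Wf Ff.
exists (sup_out g) => //=.
have -> : f @` `[0, 1] = g @` `[0, 1].
  by apply: eq_imagel => x x01; apply: fg.
exact: names_least_name.
Qed.

Definition BVname_of (F : tot tFun) (ex : W11_name F) : BVname R :=
  exist _ (F, sval (cid ex))
    (conj (proj2 (svalP (cid ex))) (let: And3 bf _ _ := proj1 (svalP (cid ex)) in bf)).

Lemma disc_from_Omega : computable_in_Omega R (W11_functional disc_out).
Proof.
move=> Om HOm.
have [d Hd] := @ucomp_jump_enum R Om HOm (BVname R * nat * nat)
  (fun y => [:: num y.1.2, num y.2 & base Om y.1.1]) 2 (fun y => y.1.1)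
  (fun=> erefl) (fun y => y.1.2) (fun y => y.2) ltac:(uvar) ltac:(uvar).
have [e He] : ucomp (fun y : BVname R * nat * nat =>
    [:: targ (sval y.1.1).1; num y.1.2; num y.2; parg Om; targ E2])
    (fun y => disc_out (sval y.1.1).2 y.1.2 y.2).
  (* The numerical arguments are moved in front of the function, as the program expects them before
     [base]. *)
  apply: (ucomp_univ (ps := [:: 1; 2; 0; 3; 4]%N) (m := fun=> d)) => //.
  - by exists 5%N.
  - exact: ucomp_const.
exists e => -[F [n [j []]]] a; rewrite /W11_functional /=.
case: pselect => // ex [<-]; exact: (He (BVname_of ex, n, j)).
Qed.

Lemma sup_from_Omega : computable_in_Omega R (W11_functional sup_out).
Proof.
move=> Om HOm.
have [d Hd] := @ucomp_sup R Om HOm (BVname R * nat)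
  (fun y => num y.2 :: base Om y.1) 1 (fun y => y.1)
  (fun=> erefl) (fun y => y.2) ltac:(uvar).
have [e He] : ucomp (fun y : BVname R * nat =>
    [:: targ (sval y.1).1; num y.2; parg Om; targ E2])
    (fun y => sup_out (sval y.1).2 y.2).
  apply: (ucomp_univ (ps := [:: 1; 0; 2; 3]%N) (m := fun=> d)) => //.
  - by exists 4%N.
  - exact: ucomp_const.
exists e => -[F [j []]] a; rewrite /W11_functional /=.
case: pselect => // ex [<-]; exact: (He (BVname_of ex, j)).
Qed.
End TasksFromOmega.

Theorem theorem4p40 (R : realType) :
  task_in_Omega_cluster R (W11_discontinuities_task R) /\
  task_in_Omega_cluster R (W11_sup_task R).
Proof.
split; split.
- exact: Omega_from_discontinuities.
- exists (W11_functional (@disc_out R)); first exact: performs_disc.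
  split => //; first exact: disc_from_Omega.
  exact: Omega_from_discontinuities (@performs_disc R).
- exact: Omega_from_sup.
- exists (W11_functional (@sup_out R)); first exact: performs_sup.
  split => //; first exact: sup_from_Omega.
  exact: Omega_from_sup (@performs_sup R).
Qed.
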